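(* Let $M$ be a macro-element and $T\subseteq M$ any tetrahedron of the grid contained in $M$, with vertices $a_1,a_2,a_3,a_4$, and let $a_{ij}=(a_i+a_j)/2$ for $1\le i<j\le4$ be the midpoints of its edges. For any function $q\in N_M$, $$q|_T(a_{ij})=q|_T(a_{kl})$$ whenever $i,j,k,l$ are distinct integers in $\{1,2,3,4\}$ with $i<j$ and $k<l$.
   Context: $\Omega\subset\mathbb{R}^3$ is a bounded polyhedral domain with Lipschitz boundary and $\mathcal{T}_h$ is a tetrahedral grid of $\Omega$ (from a quasi-uniform family) such that each $T\in\mathcal{T}_h$ has at least one vertex in the interior of $\Omega$. A macro-element $M$ is the union of all tetrahedrons of $\mathcal{T}_h$ having a given internal vertex $a$ of $\mathcal{T}_h$ as one of their vertices; $T\subseteq M$ always means a tetrahedron of $\mathcal{T}_h$ contained in this union. $P_m(S)$ is the space of polynomials of degree at most $m$ on $S$. For each tetrahedron $T$ a numbering of its vertices is fixed, $\lambda_1,\dots,\lambda_4$ are the corresponding barycentric coordinates, and $$P_4^-(T)=P_3(T)+\operatorname{span}\{\lambda_1^2\lambda_3\lambda_4,\ \lambda_2^2\lambda_4\lambda_1,\ \lambda_3^2\lambda_1\lambda_2,\ \lambda_4^2\lambda_2\lambda_3,\ \lambda_1\lambda_2^3\},\qquad \boldsymbol{P}_4^-(T)=(P_4^-(T))^3.$$ A piecewise polynomial vector field $\boldsymbol{v}$ on $M$ is $M_2$-continuous on $M$ if, for every face $F$ of the grid interior to $M$, $\int_F[\![\boldsymbol{v}]\!]\cdot\boldsymbol{q}\,ds=0$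 for all $\boldsymbol{q}\in (P_2(F))^3$, where $[\![\boldsymbol{v}]\!]$ is the jump (difference of the traces from the two sides) across $F$; it is $M_2$-zero on $\partial M$ if $\int_F\boldsymbol{v}\cdot\boldsymbol{q}\,ds=0$ for all $\boldsymbol{q}\in (P_2(F))^3$ and all faces $F\subset\partial M$. Define $$\boldsymbol{V}_{0,M}=\{\boldsymbol{v}\in \boldsymbol{L}^2(M): \boldsymbol{v}|_T\in\boldsymbol{P}_4^-(T)\ \forall T\subseteq M,\ \boldsymbol{v}\text{ is }M_2\text{-continuous on }M\text{ and }M_2\text{-zero on }\partial M\},$$ $$Q_{0,M}=\Big\{q\in L^2(M): q|_T\in P_2(T)\ \forall T\subseteq M,\ \int_M q\,dx=0\Big\},$$ $$N_M=\Big\{q\in Q_{0,M}:\int_M\operatorname{div}_h\boldsymbol{v}\,q\,dx=0\ \text{ for all }\boldsymbol{v}\in\boldsymbol{V}_{0,M}\Big\},$$ where $\operatorname{div}_h$ is the element-wise divergence. *)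

(* Defs.v *)
From HB Require Import structures.
From mathcomp Require Import all_boot all_order all_algebra.
From mathcomp Require Import all_classical all_reals all_analysis.

Set Implicit Arguments.
Unset Strict Implicit.
Unset Printing Implicit Defensive.

Import Order.TTheory GRing.Theory Num.Theory.
Import numFieldNormedType.Exports.

Local Open Scope classical_set_scope.
Local Open Scope ring_scope.

(* The points of R^3.  The norm of this normed module is the sup norm; only its
   topology and its derivatives are used.  Distances are taken with enorm. *)
Notation pt R := (R * R * R)%type.

Section Euclidean.
Variable R : realType.
Implicit Types (x y : pt R) (A : set (pt R)).

Definition coord x (i : 'I_3) : R := [:: x.1.1; x.1.2; x.2]`_i.

Definition unit_vec (i : 'I_3) : pt R :=
  ((i == 0%N :> nat)%:R, (i == 1%N :> nat)%:R, (i == 2%N :> nat)%:R).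

Definition dot x y : R := \sum_i coord x i * coord y i.

Definition enorm x : R := Num.sqrt (dot x x).

Definition diam A : R := sup [set enorm (u.1 - u.2) | u in A `*` A].

Definition eball x (r : R) : set (pt R) := [set y | enorm (y - x) < r].

Definition boundary A : set (pt R) := closure A `\` interior A.

Definition mu2 := (@lebesgue_measure R \x @lebesgue_measure R)%E.

Definition mu3 := (mu2 \x @lebesgue_measure R)%E.

Definition inL2 A (f : pt R -> R) : Prop := f \_ A \in Lfun mu3 2%:E.

(* The members of P_m are functions on all of R^3; P_m(S) consists of their
   restrictions to S. *)
Definition Pm (m : nat) (f : pt R -> R) : Prop :=
  exists c : nat -> nat -> nat -> R, forall x,
    f x = \sum_(i < m.+1) \sum_(j < m.+1) \sum_(k < m.+1 | (i + j + k <= m)%N)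
            c i j k * x.1.1 ^+ i * x.1.2 ^+ j * x.2 ^+ k.

Definition divergence (v : 'I_3 -> pt R -> R) x : R :=
  \sum_i 'D_(unit_vec i) (v i) x.

End Euclidean.

Section Domain.
Variable R : realType.
Implicit Type Omega : set (pt R).

(* The boundary lies in finitely many planes [n . x = c]. *)
Definition polyhedral Omega : Prop :=
  exists P : seq (pt R * R), (forall p, p \in P -> p.1 != 0) /\
    forall x, boundary Omega x -> exists2 p, p \in P & dot p.1 x = p.2.

(* Near every boundary point, in suitable orthonormal coordinates centred
   there, Omega is the strict epigraph of a Lipschitz function. *)
Definition lipschitz_boundary Omega : Prop :=
  forall x, boundary Omega x ->
  exists (e : 'I_3 -> pt R) (r h L : R) (phi : R * R -> R),
  [/\ forall i j, dot (e i) (e j) = (i == j)%:R,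
      0 < r /\ 0 < h,
      forall s t, `|phi s - phi t| <=
                  L * Num.sqrt ((s.1 - t.1) ^+ 2 + (s.2 - t.2) ^+ 2) &
      forall y, let z0 := dot (y - x) (e (inord 0)) in
        let z1 := dot (y - x) (e (inord 1)) in
        let z2 := dot (y - x) (e (inord 2)) in
        `|z0| < r -> `|z1| < r -> `|z2| < h ->
        (Omega y <-> phi (z0, z1) < z2)].

Definition polyhedral_lipschitz_domain Omega : Prop :=
  [/\ Omega !=set0, open Omega, connected Omega, bounded_set Omega &
      polyhedral Omega /\ lipschitz_boundary Omega].

End Domain.

(* A tetrahedron is given by its numbered vertices. *)
Section Tetrahedron.
Variables (R : realType) (a : 'I_4 -> pt R).

(* The convex hull of the vertices with index in J; it is empty if J is. *)
Definition hull (J : {set 'I_4}) : set (pt R) :=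
  [set x | exists l : 'I_4 -> R,
     [/\ forall i, 0 <= l i, forall i, i \notin J -> l i = 0,
         \sum_i l i = 1 & x = \sum_i l i *: a i]].

Definition tet : set (pt R) := hull [set: 'I_4]%SET.

Definition face (i : 'I_4) : set (pt R) := hull [set~ i]%SET.

Definition midpoint (i j : 'I_4) : pt R := 2^-1 *: (a i + a j).

Definition hom_coord (x : pt R) : 'rV[R]_4 :=
  \row_j [:: 1; x.1.1; x.1.2; x.2]`_j.

Definition vertex_mx : 'M[R]_4 := \matrix_(i, j) hom_coord (a i) 0 j.

Definition nondegenerate : bool := vertex_mx \in unitmx.

(* The solution of \sum_i bary i x = 1 and \sum_i bary i x *: a i = x. *)
Definition bary (i : 'I_4) (x : pt R) : R :=
  (hom_coord x *m invmx vertex_mx) 0 i.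

Definition P4m (f : pt R -> R) : Prop :=
  exists2 p, Pm 3 p & exists c : 'I_5 -> R, forall x,
    let l1 := bary (inord 0) x in let l2 := bary (inord 1) x in
    let l3 := bary (inord 2) x in let l4 := bary (inord 3) x in
    f x = p x + \sum_(k < 5) c k *
      [:: l1 ^+ 2 * l3 * l4; l2 ^+ 2 * l4 * l1; l3 ^+ 2 * l1 * l2;
          l4 ^+ 2 * l2 * l3; l1 * l2 ^+ 3]`_k.

(* The surface integral over face i, parametrized by the unit triangle; the
   factor is the norm of the cross product of the edge vectors u and w. *)
Definition face_integral (i : 'I_4) (f : pt R -> R) : R :=
  let b0 := a (lift i (inord 0)) in
  let u := a (lift i (inord 1)) - b0 in
  let w := a (lift i (inord 2)) - b0 in
  Num.sqrt (dot u u * dot w w - dot u w ^+ 2) *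
  (\int[@mu2 R]_(s in [set s : R * R | [/\ 0 <= s.1, 0 <= s.2 & s.1 + s.2 <= 1]])
     f (b0 + s.1 *: u + s.2 *: w)).

(* The polynomial that coincides with f almost everywhere on the tetrahedron,
   unique as soon as the latter is nondegenerate.  If there is none the value
   is f, which then is not a polynomial, so that for a space P of polynomials
   [P (restr f)] says exactly that f restricted to the tetrahedron is in P.
   As a polynomial it also has traces on the faces and values at all points. *)
Definition restr (f : pt R -> R) : pt R -> R :=
  xget f [set p | (exists m, Pm m p) /\ ae_eq (@mu3 R) tet f p].

End Tetrahedron.

(* A finite family of tetrahedra with a fixed numbering of the vertices of
   each of them. *)
Record grid (R : realType) := Grid {
  cell : finType;
  vtx : cell -> 'I_4 -> pt R }.

Section Grid.
Variables (R : realType) (th : grid R).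
Implicit Types (K : cell th) (Omega : set (pt R)).

Definition common K K' : {set 'I_4} :=
  [set i | [exists j, vtx K i == vtx K' j]]%SET.

(* The last clause is the conformity of the grid: two distinct tetrahedra have
   an empty intersection or share exactly a common vertex, edge or face. *)
Definition tetrahedral_grid Omega : Prop :=
  [/\ forall K, nondegenerate (vtx K),
      closure Omega = \bigcup_(K in [set: cell th]) tet (vtx K) &
      forall K K', K != K' -> common K K' != [set: 'I_4]%SET /\
        tet (vtx K) `&` tet (vtx K') = hull (vtx K) (common K K')].

Definition internal_vertex Omega (a : pt R) : Prop :=
  Omega a /\ exists K i, vtx K i = a.

Definition macro (a : pt R) : set (pt R) :=
  \bigcup_(K in [set K : cell th | exists i, vtx K i = a]) tet (vtx K).

End Grid.

(* A family of grids is quasi-uniform if it is shape regular and the diameters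
   within one grid are comparable, uniformly over the family. *)
Definition quasi_uniform (R : realType) (H : Type) (Th : H -> grid R) : Prop :=
  exists2 C : R, 0 < C & forall h (K : cell (Th h)),
    (exists x, eball x (diam (tet (vtx K)) / C) `<=` tet (vtx K)) /\
    (forall K' : cell (Th h), diam (tet (vtx K')) <= C * diam (tet (vtx K))).

Section Spaces.
Variables (R : realType) (th : grid R) (M : set (pt R)).
Implicit Types (K : cell th) (v : 'I_3 -> pt R -> R) (q : pt R -> R).

Definition inside K : Prop := tet (vtx K) `<=` M.

Definition P2_vector (w : 'I_3 -> pt R -> R) : Prop := forall i, Pm 2 (w i).

(* The faces of the grid interior to M are those shared by two distinct
   tetrahedra of M, which lie on the two sides of it. *)
Definition M2_continuous v : Prop :=
  forall K K' i i', inside K -> inside K' -> K != K' ->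
    face (vtx K) i = face (vtx K') i' ->
    forall w, P2_vector w ->
      face_integral (vtx K) i (fun x =>
        \sum_j (restr (vtx K) (v j) x - restr (vtx K') (v j) x) * w j x) = 0.

Definition M2_zero v : Prop :=
  forall K i, inside K -> face (vtx K) i `<=` boundary M ->
    forall w, P2_vector w ->
      face_integral (vtx K) i (fun x =>
        \sum_j restr (vtx K) (v j) x * w j x) = 0.

Definition V0 v : Prop :=
  [/\ forall j, inL2 M (v j),
      forall K j, inside K -> P4m (vtx K) (restr (vtx K) (v j)),
      M2_continuous v & M2_zero v].

Definition Q0 q : Prop :=
  [/\ inL2 M q,
      forall K, inside K -> Pm 2 (restr (vtx K) q) &
      \int[@mu3 R]_(x in M) q x = 0].

(* The interiors of the tetrahedra are disjoint and cover M up to a null set. *)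
Definition div_h v (x : pt R) : R :=
  \sum_(K : cell th | `[< inside K >])
    \1_(interior (tet (vtx K))) x * divergence (fun j => restr (vtx K) (v j)) x.

Definition NM q : Prop :=
  Q0 q /\ forall v, V0 v -> \int[@mu3 R]_(x in M) (div_h v x * q x) = 0.

End Spaces.

(* Main.v *)
Require Import Defs.
From HB Require Import structures.
From mathcomp Require Import all_boot all_order all_algebra.
From mathcomp Require Import all_classical all_reals all_analysis.
From mathcomp Require Import measurable_realfun.
From mathcomp Require Import ring lra zify.
Set Implicit Arguments.
Unset Strict Implicit.
Unset Printing Implicit Defensive.
Import Order.TTheory GRing.Theory Num.Theory.
Import numFieldNormedType.Exports.
Local Open Scope classical_set_scope.
Local Open Scope ring_scope.

(** Let l_1, ..., l_4 be the barycentric coordinates of a cell T.  The cubic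
    polynomial

      b = 12 - 45 \sum_m l_m^2 + 35 \sum_m l_m^3

    is orthogonal, on each face of T, to all polynomials of degree 2 on that
    face.  Indeed on a face one coordinate vanishes, so that b becomes the same
    expression in the three coordinates of the face; being symmetric, it only
    has to be tested against symmetric polynomials of degree 2, that is against
    1 and the sum of squares.  These are two linear conditions on combinations
    of 1, \sum l_m^2 and \sum l_m^3, and b solves them
    ([bubble_face_moment]).

    Hence, for a fixed vector d, the field that is b d on T and 0 elsewhere
    lies in V_{0,M} ([V0_bubble_field]), and testing q with it gives
    \int_T (D_d b) q = 0.  An integration by parts would turn this into
    \int_T b (D_d q) = 0.  Here D_d q is affine and b is symmetric with a mean
    different from 0, so that D_d q vanishes at the centroid of T.  Take
    d = a_ij - a_kl.  The centroid is the middle of the segment between the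
    midpoints a_ij and a_kl, hence D_d q at the centroid is
    q(a_ij) - q(a_kl), because q is quadratic.

    Instead of integrating by parts, the integral of (D_d b) q is computed.
    With sig_m = D_d l_m, which add up to 0, one has
    D_d b = \sum_m sig_m (105 l_m^2 - 90 l_m), and on the reference simplex the
    integral of D_d b against l_p l_q is - (sig_p + sig_q) / 24
    ([bubble_grad_moment]).  A polynomial of degree 2 is a sum of products of
    two affine functions ([Pm2_prod]), and collecting terms yields
    - (q(a_ij) - q(a_kl)) / 6 ([midpoint_moment]).

    The passage to the reference simplex needs a change of variables for
    affine maps of space, up to a positive constant: such a map is a
    composition of maps that keep some of the coordinates fixed, and Fubini's
    theorem reduces these to affine maps of the line ([scales_lin3]).  The
    moments on the reference simplex are iterated beta integrals.

    The values [restr] are under control because a polynomial that vanishes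
    almost everywhere on a nondegenerate tetrahedron is 0 ([restr_unique]), and
    because two distinct cells meet in a part of a face, which has measure 0
    ([bary_null]). *)

(** * Linear maps of space scale volume *)

(** Change of variables with a constant Jacobian.  The factor c is that of
    preimages, hence the inverse of the absolute value of the determinant when
    f is linear. *)
Definition scales d (T : measurableType d) (R : realType)
    (m : set T -> \bar R) (c : R) (f : T -> T) :=
  [/\ measurable_fun setT f, 0 < c &
      forall A, measurable A -> m (f @^-1` A) = (c%:E * m A)%E].

Lemma scales_comp d (T : measurableType d) (R : realType)
    (m : set T -> \bar R) c c' f g :
  scales m c f -> scales m c' g -> scales m (c' * c) (f \o g).
Proof.
move=> [mf c0 fE] [mg c'0 gE]; split; first exact: measurableT_comp.
  exact: mulr_gt0.
move=> A mA; rewrite comp_preimage gE ?fE ?muleA //.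
by rewrite -[X in measurable X]setTI; exact: mf.
Qed.

Section Fibres.
Context d1 d2 (T1 : measurableType d1) (T2 : measurableType d2) (R : realType).
Variable m1 : {sigma_finite_measure set T1 -> \bar R}.
Variable m2 : {sigma_finite_measure set T2 -> \bar R}.

(** Fubini's theorem: f moves points inside the fibres {x} x T2 only, and
    scales the measure of all of them by the same factor. *)
Lemma scales_fibre_r c (f : T1 * T2 -> T1 * T2) (phi : T1 -> T2 -> T2) :
  measurable_fun setT f -> (forall x, scales m2 c (phi x)) ->
  (forall u, f u = (u.1, phi u.1 u.2)) -> scales (m1 \x m2)%E c f.
Proof.
move=> mf sphi fE; split=> //; first by have [] := sphi point.
have [_ c0 _] := sphi point.
move=> A mA; rewrite /product_measure1 -ge0_integralZl //; last 2 first.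
- exact: measurable_fun_xsection.
- by rewrite lee_fin ltW.
apply: eq_integral => x _ /=; have [_ _ <-] := sphi x.
  congr (m2 _); apply/seteqP; split => y; rewrite /xsection /= !inE /= fE //.
exact: measurable_xsection.
Qed.

Lemma product_measure_sym A : measurable A -> (m1 \x m2)%E A = (m1 \x^ m2)%E A.
Proof.
move=> mA; apply: product_measure_unique => // A1 A2 mA1 mA2.
exact: product_measure2E.
Qed.

Lemma scales_fibre_l c (f : T1 * T2 -> T1 * T2) (phi : T2 -> T1 -> T1) :
  measurable_fun setT f -> (forall y, scales m1 c (phi y)) ->
  (forall u, f u = (phi u.2 u.1, u.2)) -> scales (m1 \x m2)%E c f.
Proof.
move=> mf sphi fE; split=> //; first by have [] := sphi point.
have [_ c0 _] := sphi point.
move=> A mA; rewrite !product_measure_sym //; last first.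
  by rewrite -[X in measurable X]setTI; exact: mf.
rewrite /product_measure2 -ge0_integralZl //; last 2 first.
- exact: measurable_fun_ysection.
- by rewrite lee_fin ltW.
apply: eq_integral => y _ /=; have [_ _ <-] := sphi y.
  congr (m1 _); apply/seteqP; split => x; rewrite /ysection /= !inE /= fE //.
exact: measurable_ysection.
Qed.

Lemma scales_prod c1 c2 (f1 : T1 -> T1) (f2 : T2 -> T2) :
  scales m1 c1 f1 -> scales m2 c2 f2 ->
  scales (m1 \x m2)%E (c1 * c2) (fun u => (f1 u.1, f2 u.2)).
Proof.
move=> s1 s2; have [mf1 _ _] := s1; have [mf2 _ _] := s2.
have sl : scales (m1 \x m2)%E c1 (fun u => (f1 u.1, u.2)).
  apply: (@scales_fibre_l _ _ (fun _ => f1)) => //.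
  by apply: measurable_fun_pair => //=; exact: (measurableT_comp mf1 measurable_fst).
have sr : scales (m1 \x m2)%E c2 (fun u => (u.1, f2 u.2)).
  apply: (@scales_fibre_r _ _ (fun _ => f2)) => //.
  by apply: measurable_fun_pair => //=; exact: (measurableT_comp mf2 measurable_snd).
exact: scales_comp sr sl.
Qed.

End Fibres.

Section Affine1.
Variable R : realType.
Notation leb := (@lebesgue_measure R).

Lemma measurable_affine1 (k g : R) :
  measurable_fun setT (fun z : measurableTypeR R => k * z + g : measurableTypeR R).
Proof.
apply: measurable_funD => //; apply: measurable_funM => //.
Qed.

(** Lebesgue measure is determined by its values on the intervals ]a, b]. *)
Lemma scales_affine (k g : R) : k != 0 ->
  scales leb `|k|^-1 (fun z => k * z + g).
Proof.
move=> k0; have nk0 : 0 < `|k| by rewrite normr_gt0.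
have mf := measurable_affine1 k g.
split => //; first by rewrite invr_gt0.
move=> A mA.
pose f := fun z : measurableTypeR R => k * z + g : measurableTypeR R.
pose kn := NngNum (ltW nk0).
pose mu' : {measure set (measurableTypeR R) -> \bar R} :=
  mscale kn (measure_function_pushforward__canonical__measure_function_Measure leb mf).
have -> // := @lebesgue_measure_unique R mu' _ A mA.
  rewrite /mu' /mscale /= muleA -EFinM mulVf ?gt_eqF// mul1e //.
move=> X [[a b]] _ <-; transitivity (`|k|%:E * leb (f @^-1` `]a, b]))%E; last by [].
have [k_gt0|k_lt0|/eqP] := ltrgtP k 0; last by rewrite (negbTE k0).
- have -> : f @^-1` `]a, b] = `[(b - g) / k, (a - g) / k[%classic.
    apply/seteqP; split => z /=; rewrite !in_itv /= /f.
      by rewrite ler_ndivrMr // ltr_ndivlMr // => /andP[? ?]; apply/andP; split; lra.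
    by rewrite ler_ndivrMr // ltr_ndivlMr // => /andP[? ?]; apply/andP; split; lra.
  rewrite !lebesgue_measure_itv /= !lte_fin ltr_nM2r ?invr_lt0 // ltrBlDr subrK.
  case: ifP => _; rewrite ?mule0 // -!EFinB -EFinM ltr0_norm //; congr _%:E.
  by field; rewrite lt_eqF.
- have -> : f @^-1` `]a, b] = `](a - g) / k, (b - g) / k]%classic.
    apply/seteqP; split => z /=; rewrite !in_itv /= /f.
      by rewrite ltr_pdivrMr // ler_pdivlMr // => /andP[? ?]; apply/andP; split; lra.
    by rewrite ltr_pdivrMr // ler_pdivlMr // => /andP[? ?]; apply/andP; split; lra.
  rewrite !lebesgue_measure_itv /= !lte_fin ltr_pM2r ?invr_gt0 // ltrBlDr subrK.
  case: ifP => _; rewrite ?mule0 // -!EFinB -EFinM gtr0_norm //; congr _%:E.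
  by field; rewrite gt_eqF.
Qed.
End Affine1.

Section Mu2.
Variable R : realType.
Notation leb := (@lebesgue_measure R).
Notation R1 := (measurableTypeR R).

HB.instance Definition _ := Measure.on (@mu2 R).

Lemma mu2_sigma_finite : sigma_finite setT (@mu2 R).
Proof.
have mF (n : nat) : measurable (`[- n%:R, n%:R] : set R1) by exact: measurable_itv.
exists (fun n => `[- n%:R, n%:R] `*` `[- n%:R, n%:R]) => [|n].
  apply/seteqP; split => // -[x y] _.
  exists (Num.bound (`|x| + `|y|)) => //=; rewrite !in_itv /= -!ler_norml.
  have /ltW xyn := archi_boundP (addr_ge0 (normr_ge0 x) (normr_ge0 y)).
  by split; apply: le_trans xyn; rewrite ?lerDl ?lerDr.
split; first exact: measurableX.
rewrite /= /mu2 product_measure1E //.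
suff : (leb `[(- n%:R)%R, n%:R%R]%classic < +oo)%E by move=> ?; rewrite lte_mul_pinfty // ge0_fin_numE.
rewrite lebesgue_measure_itv /=; case: ifP => // _; exact: ltry.
Qed.

HB.instance Definition _ := Measure_isSigmaFinite.Build _ _ _ (@mu2 R) mu2_sigma_finite.

Lemma mu2_setX (A B : set R1) : measurable A -> measurable B ->
  @mu2 R (A `*` B) = (@lebesgue_measure R A * @lebesgue_measure R B)%E.
Proof. exact: product_measure1E. Qed.

Lemma mu3_setX (A : set (R1 * R1)) (B : set R1) : measurable A -> measurable B ->
  @mu3 R (A `*` B) = (@mu2 R A * @lebesgue_measure R B)%E.
Proof. exact: (product_measure1E (@mu2 R)). Qed.

End Mu2.

Section Linear.
Variable R : realType.
Notation leb := (@lebesgue_measure R).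
Notation R1 := (measurableTypeR R).

Definition lin2 (p q r s : R) (u : R1 * R1) : R1 * R1 :=
  (p * u.1 + q * u.2, r * u.1 + s * u.2).

Lemma measurable_lin2 p q r s : measurable_fun setT (lin2 p q r s).
Proof.
apply: measurable_fun_pair => /=; apply: measurable_funD; apply: measurable_funM => //.
Qed.

Lemma scales_translation1 (t : R) : scales leb 1 (fun z : R1 => z + t : R1).
Proof.
have := @scales_affine R 1 t (oner_neq0 _); rewrite normr1 invr1.
by under eq_fun do rewrite mul1r.
Qed.

Lemma scales_translation2 (t : R1 * R1) :
  scales (@mu2 R) 1 (fun u : R1 * R1 => (u.1 + t.1, u.2 + t.2) : R1 * R1).
Proof.
rewrite -[1%R]mulr1.
exact: (scales_prod (m1 := leb) (m2 := leb) (scales_translation1 t.1) (scales_translation1 t.2)).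
Qed.

Lemma scales_translation3 (t : pt R) :
  scales (@mu3 R) 1 (fun u : R1 * R1 * R1 => (u : pt R) + t : R1 * R1 * R1).
Proof.
rewrite -[1%R]mulr1.
exact: (scales_prod (m1 := @mu2 R) (m2 := leb) (scales_translation2 t.1) (scales_translation1 t.2)).
Qed.

(** Gaussian elimination: x is changed first with y fixed, then y with the new
    x fixed. *)
Lemma scales_lin2_pivot p q r s : p != 0 -> p * s - q * r != 0 ->
  exists c, scales (@mu2 R) c (lin2 p q r s).
Proof.
move=> p0 d0; have k0 : s - r / p * q != 0.
  by apply: contraNneq d0 => k0; apply/eqP; rewrite -(mulr0 p) -k0; field.
pose f := fun u : R1 * R1 => (p * u.1 + q * u.2, u.2) : R1 * R1.
pose g := fun u : R1 * R1 => (u.1, (s - r / p * q) * u.2 + r / p * u.1) : R1 * R1.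
have -> : lin2 p q r s = g \o f.
  by apply/funext => u; rewrite /lin2 /g /f /=; congr pair; field.
exists (`|p|^-1 * `|s - r / p * q|^-1); apply: scales_comp.
  apply: (@scales_fibre_r _ _ _ _ _ leb leb _ _ (fun x y => (s - r / p * q) * y + r / p * x)) => //.
    apply: measurable_fun_pair => //=.
    by apply: measurable_funD; exact: measurable_funM.
  by move=> x; exact: scales_affine.
apply: (@scales_fibre_l _ _ _ _ _ leb leb _ _ (fun y x => p * x + q * y)) => //.
  apply: measurable_fun_pair => //=.
  by apply: measurable_funD; exact: measurable_funM.
by move=> x; exact: scales_affine.
Qed.

(** If the pivot is 0, a shear brings the second column into its place. *)
Lemma scales_lin2 p q r s : p * s - q * r != 0 ->
  exists c, scales (@mu2 R) c (lin2 p q r s).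
Proof.
move=> d0; have [p0|p0] := eqVneq p 0; last exact: scales_lin2_pivot.
have q0 : q != 0 by apply: contraNneq d0 => ->; rewrite p0 !mul0r subrr.
have -> : lin2 p q r s = lin2 q q (r + s) s \o lin2 1 0 (-1) 1.
  by apply/funext => u; rewrite /lin2 /= p0; congr pair; ring.
have [c1 s1] : exists c, scales (@mu2 R) c (lin2 q q (r + s) s).
  apply: scales_lin2_pivot => //; apply: contraNneq d0 => <-; rewrite p0; apply/eqP; ring.
have [c2 s2] : exists c, scales (@mu2 R) c (lin2 1 0 (-1) 1).
  by apply: scales_lin2_pivot; rewrite ?oner_eq0 // mul1r mul0r subr0 oner_eq0.
by exists (c2 * c1); exact: scales_comp.
Qed.

(** The linear map with columns c1, c2 and c3. *)
Definition lin3 (c1 c2 c3 : pt R) (u : R1 * R1 * R1) : R1 * R1 * R1 :=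
  u.1.1 *: c1 + u.1.2 *: c2 + u.2 *: c3.

Definition det3 (c1 c2 c3 : pt R) : R :=
  c1.1.1 * (c2.1.2 * c3.2 - c3.1.2 * c2.2)
  - c2.1.1 * (c1.1.2 * c3.2 - c3.1.2 * c1.2)
  + c3.1.1 * (c1.1.2 * c2.2 - c2.1.2 * c1.2).

Lemma lin3E c1 c2 c3 u : lin3 c1 c2 c3 u =
 (u.1.1 * c1.1.1 + u.1.2 * c2.1.1 + u.2 * c3.1.1,
  u.1.1 * c1.1.2 + u.1.2 * c2.1.2 + u.2 * c3.1.2,
  u.1.1 * c1.2 + u.1.2 * c2.2 + u.2 * c3.2).
Proof. by []. Qed.

Lemma scales_shear (al be : R) :
  scales (@mu3 R) 1 (fun u : R1 * R1 * R1 => (u.1, u.2 + (al * u.1.1 + be * u.1.2)) : R1 * R1 * R1).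
Proof.
apply: (@scales_fibre_r _ _ _ _ _ (@mu2 R) leb _ _ (fun x z => z + (al * x.1 + be * x.2))) => //.
  apply: measurable_fun_pair => //=.
  apply: measurable_funD => //.
  by apply: measurable_funD; apply: measurable_funM => //; exact: measurableT_comp.
move=> x.
have := @scales_affine R 1 (al * x.1 + be * x.2) (oner_neq0 _); rewrite normr1 invr1.
by under eq_fun do rewrite mul1r.
Qed.

(** The same elimination by blocks: the first two coordinates are changed by
    the upper left block followed by a translation that depends on z, then z by
    an affine map that depends on the new first two coordinates. *)
Lemma scales_lin3_pivot c1 c2 c3 :
  c1.1.1 * c2.1.2 - c2.1.1 * c1.1.2 != 0 -> det3 c1 c2 c3 != 0 ->
  exists c, scales (@mu3 R) c (lin3 c1 c2 c3).
Proof.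
move=> d0 D0.
set D2 := c1.1.1 * c2.1.2 - c2.1.1 * c1.1.2 in d0.
pose P := lin2 c1.1.1 c2.1.1 c1.1.2 c2.1.2.
pose f := fun u : R1 * R1 * R1 =>
  (((P u.1).1 + u.2 * c3.1.1, (P u.1).2 + u.2 * c3.1.2), u.2) : R1 * R1 * R1.
(* (al, be) is the third row of the first two columns, expressed in the new
   coordinates: the row (c1.2, c2.2) times the inverse of the block. *)
pose al := (c1.2 * c2.1.2 - c2.2 * c1.1.2) / D2.
pose be := (c2.2 * c1.1.1 - c1.2 * c2.1.1) / D2.
pose k := det3 c1 c2 c3 / D2.
have k0 : k != 0 by rewrite mulf_neq0 // invr_eq0.
pose g := fun u : R1 * R1 * R1 => (u.1, k * u.2 + (al * u.1.1 + be * u.1.2)) : R1 * R1 * R1.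
have -> : lin3 c1 c2 c3 = g \o f.
  apply/funext => -[[x y] z]; rewrite lin3E /g /f /P /lin2 /= /k /al /be /det3.
  rewrite /D2 in d0 *; congr (_, _, _); first by ring.
    by ring.
  by field.
have [c sP] := @scales_lin2 c1.1.1 c2.1.1 c1.1.2 c2.1.2 d0.
exists (c * 1 * `|k|^-1); apply: scales_comp.
  apply: (@scales_fibre_r _ _ _ _ _ (@mu2 R) leb _ _ (fun x z => k * z + (al * x.1 + be * x.2))) => //.
    apply: measurable_fun_pair => //=.
    apply: measurable_funD; first exact: measurable_funM.
    by apply: measurable_funD; apply: measurable_funM => //; exact: measurableT_comp.
  by move=> x; exact: scales_affine.
apply: (@scales_fibre_l _ _ _ _ _ (@mu2 R) leb _ _
  (fun z x => ((P x).1 + z * c3.1.1, (P x).2 + z * c3.1.2))) => //; last first.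
  by move=> z; apply: (scales_comp (scales_translation2 (z * c3.1.1, z * c3.1.2)) sP).
have mP : measurable_fun setT (fun u : R1 * R1 * R1 => P u.1).
  by apply: measurableT_comp => //; exact: measurable_lin2.
apply: measurable_fun_pair => //=.
apply: measurable_fun_pair => //=; apply: measurable_funD.
- exact: (measurableT_comp measurable_fst mP).
- exact: measurable_funM.
- exact: (measurableT_comp measurable_snd mP).
- exact: measurable_funM.
Qed.

(** If the upper left block is singular, adding c3 to c1 or to c2 makes it
    regular; otherwise all the minors of the first two rows would be 0, and the
    determinant with them. *)
Lemma scales_lin3 c1 c2 c3 : det3 c1 c2 c3 != 0 ->
  exists c, scales (@mu3 R) c (lin3 c1 c2 c3).
Proof.
move=> D0.
have [d0|d0] := eqVneq (c1.1.1 * c2.1.2 - c2.1.1 * c1.1.2) 0; last exact: scales_lin3_pivot.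
pose E (al be : R) (u : R1 * R1 * R1) := (u.1, u.2 + (al * u.1.1 + be * u.1.2)) : R1 * R1 * R1.
have lE al be : lin3 c1 c2 c3 = lin3 (c1 + al *: c3) (c2 + be *: c3) c3 \o E (- al) (- be).
  apply/funext => -[[x y] z]; rewrite /= !lin3E /E /= /GRing.scale /=.
  by congr (_, _, _); ring.
have [al [be ab]] : exists al be,
    (c1 + al *: c3).1.1 * (c2 + be *: c3).1.2 - (c2 + be *: c3).1.1 * (c1 + al *: c3).1.2 != 0.
  have [e0|e0] := eqVneq (c3.1.1 * c2.1.2 - c2.1.1 * c3.1.2) 0; last first.
    exists 1, 0; apply: contraNneq e0 => /=; rewrite /GRing.scale /= => h; apply/eqP; lra.
  have [e1|e1] := eqVneq (c1.1.1 * c3.1.2 - c3.1.1 * c1.1.2) 0; last first.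
    exists 0, 1; apply: contraNneq e1 => /=; rewrite /GRing.scale /= => h; apply/eqP; lra.
  case/eqP: D0.
  transitivity (c3.2 * (c1.1.1 * c2.1.2 - c2.1.1 * c1.1.2)
   - c2.2 * (c1.1.1 * c3.1.2 - c3.1.1 * c1.1.2)
   - c1.2 * (c3.1.1 * c2.1.2 - c2.1.1 * c3.1.2)); first by rewrite /det3; ring.
  by rewrite d0 e0 e1 !mulr0 !subr0.
have [c sc] : exists c, scales (@mu3 R) c (lin3 (c1 + al *: c3) (c2 + be *: c3) c3).
  apply: scales_lin3_pivot => //; apply: contraNneq D0 => <-; apply/eqP.
  rewrite /det3 /= /GRing.scale /=; ring.
exists (1 * c); rewrite (lE al be); apply: scales_comp sc _; exact: scales_shear.
Qed.

End Linear.

(** * Moments of the reference triangle and simplex *)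

Section ScalesIntegral.
Context d (T : measurableType d) (R : realType).
Variable m : {measure set T -> \bar R}.

Lemma ge0_integral_scales c f (D : set T) (g : T -> \bar R) :
  scales m c f -> measurable D -> measurable_fun D g ->
  (forall x, D x -> (0 <= g x)%E) ->
  (\int[m]_(x in f @^-1` D) g (f x) = c%:E * \int[m]_(x in D) g x)%E.
Proof.
move=> [mf c0 fE] mD mg g0.
have g0' : {in D, forall y, (0 <= g y)%E} by move=> y; rewrite inE; exact: g0.
rewrite -(ge0_integral_pushforward mf m mD mg g0').
pose k := NngNum (ltW c0).
rewrite (_ : c = k%:num) // -ge0_integral_mscale //.
apply: eq_measure_integral => A mA _; exact: fE.
Qed.

End ScalesIntegral.

Section Beta.
Variable R : realType.
Notation leb := (@lebesgue_measure R).
Notation R1 := (measurableTypeR R).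

(** The beta integral of z^k (1 - z)^l over [0, 1]. *)
Definition beta (k l : nat) : R := (k`! * l`!)%:R / (k + l).+1`!%:R.

(** The substitution z := h z reduces the integral to the one over [0, 1]. *)
Lemma integral_beta (h : R) k l : 0 <= h ->
  (\int[leb]_(z in `[0%R, h]) (z ^+ k * (h - z) ^+ l)%:E =
   (h ^+ (k + l).+1 * beta k l)%:E)%E.
Proof.
rewrite le_eqVlt => /orP[/eqP <-|h0].
  by rewrite set_itv1 integral_set1 expr0n mul0r.
have mg : measurable_fun `[0%R, h] (fun z : R1 => (z ^+ k * (h - z) ^+ l)%:E).
  apply/measurable_EFinP; apply: measurable_funM; apply: measurable_funX => //.
  exact: measurable_funB.
have h0' : h != 0 by rewrite gt_eqF.
have sc := scales_affine 0 h0'.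
have := ge0_integral_scales sc (measurable_itv _ : measurable (`[0%R, h] : set R1)) mg.
have -> : (fun z : R => h * z + 0) @^-1` `[0%R, h] = `[0, 1]%classic.
  apply/seteqP; split => z /=; rewrite !in_itv /= addr0 pmulr_rge0 // => /andP[-> /=].
    by rewrite -[X in _ <= X]mulr1 (ler_pM2l h0).
  by rewrite -[X in _ -> _ <= X]mulr1 (ler_pM2l h0).
have eqF (z : R) : (((h * z + 0) ^+ k * (h - (h * z + 0)) ^+ l)%:E =
    (h ^+ (k + l))%:E * (XMonemX k l z)%:E)%E.
  rewrite -EFinM (_ : XMonemX k l z = z ^+ k * (1 - z) ^+ l) // addr0.
  by rewrite -[X in X - _]mulr1 -mulrBr !exprMn exprD; congr _%:E; ring.
under eq_integral do rewrite eqF.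
rewrite ge0_integralZl; first last.
- by rewrite lee_fin exprn_ge0 // ltW.
- by move=> z /= z01; rewrite lee_fin XMonemX_ge0.
- by apply/measurable_EFinP; exact: measurable_XMonemX.
- exact: measurable_itv.
have -> : (\int[leb]_(x in `[0%R, 1%R]) (XMonemX k l x)%:E = (beta k l)%:E)%E.
  rewrite /beta -beta_fun_fact EFin_beta_fun integral_mkcond /=.
  by apply: eq_integral => x _; rewrite restrict_EFin.
move=> H; have {}H := H _.
set I := integral _ _ _ in H *.
have {H} : ((h ^+ (k + l))%:E * (beta k l)%:E = (`|h|^-1)%:E * I)%E.
  apply: H => z /=; rewrite in_itv /= => /andP[z0 zh].
  by rewrite lee_fin mulr_ge0 // exprn_ge0 // subr_ge0.
rewrite gtr0_norm // => /(congr1 (fun e => h%:E * e)%E).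
rewrite !muleA -!EFinM divff // mul1e => <-.
by rewrite exprS.
Qed.

Lemma beta_ge0 k l : 0 <= beta k l.
Proof. by rewrite divr_ge0. Qed.

End Beta.

Section SimplexStep.
Context d (T : measurableType d) (R : realType).
Variable m : {sigma_finite_measure set T -> \bar R}.
Notation leb := (@lebesgue_measure R).
Notation R1 := (measurableTypeR R).

(** One step in the construction of a simplex: the triangle lies over [0, 1]
    and the tetrahedron over the triangle. *)
Definition subgraph (S : set T) (h : T -> R) : set (T * R1) :=
  [set u | S u.1 /\ 0 <= u.2 <= h u.1].

Lemma measurable_subgraph S h : measurable S -> measurable_fun setT h ->
  measurable (subgraph S h).
Proof.
move=> mS mh.
have -> : subgraph S h = (fst @^-1` S) `&`
    ((snd @^-1` `[0%R, +oo[) `&` ((fun u => h u.1 - u.2) @^-1` `[0%R, +oo[)).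
  apply/seteqP; split => -[p z]; rewrite /subgraph /= !in_itv /= !andbT subr_ge0.
    by move=> [? /andP[]].
  by move=> [? [-> ->]].
apply: measurableI; first by rewrite -[X in measurable X]setTI; exact: measurable_fst.
apply: measurableI; first by rewrite -[X in measurable X]setTI; exact: measurable_snd.
have mf : measurable_fun setT (fun u : T * R1 => h u.1 - u.2).
  apply: measurable_funB => //; exact: (measurableT_comp mh measurable_fst).
by rewrite -[X in measurable X]setTI; exact: mf.
Qed.

(** Integrating out the last coordinate leaves an integral of the same shape
    over the base when h is the last barycentric coordinate of the base;
    therefore the moments of simplices can be computed one dimension after the
    other. *)
Lemma integral_subgraph (S : set T) (h F : T -> R) k l :
  measurable S -> measurable_fun setT h -> measurable_fun setT F ->
  (forall p, S p -> 0 <= F p) -> (forall p, S p -> 0 <= h p) ->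
  (\int[m \x leb]_(u in subgraph S h) (F u.1 * (u.2 ^+ k * (h u.1 - u.2) ^+ l))%:E =
   (beta R k l)%:E * \int[m]_(p in S) (F p * h p ^+ (k + l).+1)%:E)%E.
Proof.
move=> mS mh mF F0 h0.
have mD := measurable_subgraph mS mh.
pose g (u : T * R1) := (F u.1 * (u.2 ^+ k * (h u.1 - u.2) ^+ l))%:E.
have mg : measurable_fun setT g.
  apply/measurable_EFinP; apply: measurable_funM.
    exact: (measurableT_comp mF measurable_fst).
  apply: measurable_funM; apply: measurable_funX => //.
  apply: measurable_funB => //; exact: (measurableT_comp mh measurable_fst).
rewrite integral_mkcond (@fubini_tonelli1 _ _ _ _ _ m leb); last 2 first.
- by apply/(measurable_restrictT _ mD); exact: measurable_funTS.
- move=> u; rewrite patchE; case: ifPn => //; rewrite inE => -[Su /andP[z0 zh]].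
  by rewrite lee_fin !mulr_ge0 ?F0 ?exprn_ge0 // subr_ge0.
rewrite -ge0_integralZl //; first last.
- by rewrite lee_fin beta_ge0.
- by move=> p Sp; rewrite lee_fin mulr_ge0 ?F0 ?exprn_ge0 ?h0.
- apply/measurable_EFinP; apply: measurable_funTS; apply: measurable_funM => //.
  exact: measurable_funX.
rewrite [RHS]integral_mkcond; apply: eq_integral => p _.
rewrite [RHS]patchE /fubini_F; case: ifPn => [|pS]; last first.
  apply: integral0_eq => z _; rewrite patchE ifN //.
  by apply: contra pS; rewrite !inE => -[].
rewrite inE => Sp.
transitivity (\int[leb]_(z in `[0%R, h p]) ((F p)%:E * (z ^+ k * (h p - z) ^+ l)%:E))%E.
  rewrite [RHS]integral_mkcond; apply: eq_integral => z _.
  rewrite !patchE; congr (if _ then _ else _).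
  by apply/idP/idP; rewrite !inE /subgraph /= in_itv /=; [case|].
rewrite ge0_integralZl; first last.
- by rewrite lee_fin F0.
- move=> z /=; rewrite in_itv /= => /andP[z0 zh].
  by rewrite lee_fin mulr_ge0 // exprn_ge0 // subr_ge0.
- apply/measurable_EFinP; apply: measurable_funM; apply: measurable_funX => //.
  exact: measurable_funB.
- exact: measurable_itv.
rewrite integral_beta ?h0 // -!EFinM; congr _%:E; ring.
Qed.

End SimplexStep.

Section Moments.
Variable R : realType.
Notation leb := (@lebesgue_measure R).
Notation R1 := (measurableTypeR R).

Definition triangle : set (R * R) :=
  [set s | [/\ 0 <= s.1, 0 <= s.2 & s.1 + s.2 <= 1]].

Definition simplex3 : set (pt R) :=
  [set s | [/\ 0 <= s.1.1, 0 <= s.1.2, 0 <= s.2 & s.1.1 + s.1.2 + s.2 <= 1]].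

Let top1 (x : R1) : R := 1 - x.
Let top2 (p : R1 * R1) : R := 1 - p.1 - p.2.

Lemma triangle_subgraph : triangle = subgraph (`[0%R, 1%R]%classic : set R1) top1.
Proof.
apply/seteqP; split => -[x y]; rewrite /triangle /subgraph /top1 /= in_itv /=.
  by move=> [x0 y0 xy]; split; apply/andP; split => //; lra.
by move=> [/andP[x0 x1] /andP[y0 xy]]; split => //; lra.
Qed.

Lemma simplex3_subgraph : simplex3 = subgraph (triangle : set (R1 * R1)) top2.
Proof.
apply/seteqP; split => -[[x y] z]; rewrite /simplex3 /triangle /subgraph /top2 /=.
  by move=> [x0 y0 z0 xyz]; split; [split => //; lra|apply/andP; split => //; lra].
by move=> [[x0 y0 xy] /andP[z0 xyz]]; split => //; lra.
Qed.

Let factr_gt0 n : 0 < n`!%:R :> R.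
Proof. by rewrite ltr0n fact_gt0. Qed.

Let mtop1 : measurable_fun setT top1.
Proof. exact: measurable_funB. Qed.

Let mtop2 : measurable_fun setT top2.
Proof. by apply: measurable_funB => //; exact: measurable_funB. Qed.

Lemma measurable_triangle : measurable (triangle : set (R1 * R1)).
Proof. by rewrite triangle_subgraph; exact: measurable_subgraph. Qed.

Lemma measurable_simplex3 : measurable (simplex3 : set (R1 * R1 * R1)).
Proof. by rewrite simplex3_subgraph; apply: measurable_subgraph => //; exact: measurable_triangle. Qed.

Lemma ge0_integral_triangle i j k :
  (\int[@mu2 R]_(s in triangle) (s.1 ^+ i * (s.2 ^+ j * (1 - s.1 - s.2) ^+ k))%:E =
   ((i`! * j`! * k`!)%:R / (i + j + k).+2`!%:R)%:E)%E.
Proof.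
rewrite triangle_subgraph (@integral_subgraph _ _ _ leb _ top1 (fun x => x ^+ i)) //; last 2 first.
- by move=> x /=; rewrite in_itv /= => /andP[x0 _]; rewrite exprn_ge0.
- by move=> x /=; rewrite in_itv /= => /andP[_ x1]; rewrite subr_ge0.
rewrite integral_beta // -EFinM; congr _%:E; rewrite expr1n mul1r /beta.
rewrite addnS -addnA.
have := lt0r_neq0 (factr_gt0 (j + k).+1); have := lt0r_neq0 (factr_gt0 (i + (j + k)).+2).
move: (j + k).+1`! (i + (j + k)).+2`! => N1 N2 N2neq0 N1neq0; rewrite !natrM.
by field; apply/andP.
Qed.

Lemma ge0_integral_simplex3 i j k l :
  (\int[@mu3 R]_(s in simplex3)
     (s.1.1 ^+ i * s.1.2 ^+ j * (s.2 ^+ k * (1 - s.1.1 - s.1.2 - s.2) ^+ l))%:E =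
   ((i`! * j`! * k`! * l`!)%:R / (i + j + k + l).+3`!%:R)%:E)%E.
Proof.
rewrite simplex3_subgraph.
rewrite (@integral_subgraph _ _ _ (@mu2 R) _ top2 (fun p => p.1 ^+ i * p.2 ^+ j)) //; last 4 first.
- exact: measurable_triangle.
- by apply: measurable_funM; apply: measurable_funX.
- by move=> p [p1 p2 _] /=; rewrite mulr_ge0 ?exprn_ge0.
- by move=> p [p1 p2 p12] /=; rewrite /top2; lra.
under eq_integral do rewrite -mulrA.
rewrite ge0_integral_triangle -EFinM; congr _%:E; rewrite /beta.
rewrite !addnS -!addnA.
have := lt0r_neq0 (factr_gt0 (k + l).+1); have := lt0r_neq0 (factr_gt0 (i + (j + (k + l))).+3).
move: (k + l).+1`! (i + (j + (k + l))).+3`! => N1 N2 N2neq0 N1neq0; rewrite !natrM.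
by field; apply/andP.
Qed.

End Moments.

(** * Affine functions and barycentric coordinates *)

Section FiniteSums.

Lemma sum3 (V : nmodType) (F : 'I_3 -> V) :
  \sum_i F i = F (inord 0) + F (inord 1) + F (inord 2).
Proof.
rewrite !big_ord_recl big_ord0 addr0 !addrA.
by congr (F _ + F _ + F _); apply/val_inj; rewrite /= inordK.
Qed.

Lemma sum4 (V : nmodType) (F : 'I_4 -> V) :
  \sum_i F i = F (inord 0) + F (inord 1) + F (inord 2) + F (inord 3).
Proof.
rewrite !big_ord_recl big_ord0 addr0 !addrA.
by congr (F _ + F _ + F _ + F _); apply/val_inj; rewrite /= inordK.
Qed.

Lemma sum_delta (R : pzRingType) (I : finType) (F : I -> R) (i : I) : \sum_k F k * (k == i)%:R = F i.
Proof.
by rewrite (bigD1 i) //= eqxx mulr1 big1 ?addr0 // => k /negbTE ->; rewrite mulr0.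
Qed.

Lemma sum_pt (R : realType) (I : finType) (f : I -> pt R) :
  \sum_i f i = (\sum_i (f i).1.1, \sum_i (f i).1.2, \sum_i (f i).2).
Proof.
have e1 : (\sum_i f i).1.1 = \sum_i (f i).1.1.
  by apply: (big_morph (fun x : pt R => x.1.1)).
have e2 : (\sum_i f i).1.2 = \sum_i (f i).1.2.
  by apply: (big_morph (fun x : pt R => x.1.2)).
have e3 : (\sum_i f i).2 = \sum_i (f i).2.
  by apply: (big_morph (fun x : pt R => x.2)).
by rewrite -e1 -e2 -e3; case: (\sum_i f i) => -[].
Qed.

End FiniteSums.

Section AffineFunctions.
Variable R : realType.

(** The constant term and the gradient of u. *)
Definition affine (u : pt R -> R) := exists A : R * pt R,
  forall x, u x = A.1 + (A.2.1.1 * x.1.1 + A.2.1.2 * x.1.2 + A.2.2 * x.2).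

Lemma affine_comb (I : finType) u (l : I -> R) (a : I -> pt R) :
  affine u -> \sum_i l i = 1 ->
  u (\sum_i l i *: a i) = \sum_i l i * u (a i).
Proof.
move=> [[A0 [[A1 A2] A3]] uE] l1; rewrite uE sum_pt /=.
under [in RHS]eq_bigr do rewrite uE /= 3!mulrDr.
rewrite !big_split /= -mulr_suml l1 mul1r !mulr_sumr; congr (_ + (_ + _ + _));
  by apply: eq_bigr => i _; rewrite mulrCA.
Qed.

Lemma affine_line (f : pt R -> R) x d t : affine f -> f (x + t *: d) = f x + t * (f (x + d) - f x).
Proof.
move: x d => [[x1 x2] x3] [[d1 d2] d3] [[A0 [[A1 A2] A3]] fE]; rewrite !fE /=.
by rewrite /GRing.scale /=; ring.
Qed.

Lemma affine_extend (u : pt R -> R) x y t : affine u ->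
  u (x + t *: (x - y)) = u x + t * (u x - u y).
Proof.
move: x y => [[x1 x2] x3] [[y1 y2] y3] [A uE]; rewrite !uE /=.
by rewrite /GRing.scale /=; ring.
Qed.

Lemma affine_diff (u : pt R -> R) x y z : affine u -> u (x + (y - z)) - u x = u y - u z.
Proof. by move=> [A uE]; rewrite !uE /=; ring. Qed.

Lemma affine_midpoint (u : pt R -> R) (a : 'I_4 -> pt R) i j :
  affine u -> u (midpoint a i j) = (u (a i) + u (a j)) / 2.
Proof.
move=> [[A0 [[A1 A2] A3]] uE]; rewrite /midpoint !uE.
case: (a i) (a j) => [[x1 x2] x3] [[y1 y2] y3] /=.
by rewrite /GRing.scale /=; field.
Qed.

(** The difference quotients of an affine function are constant. *)
Lemma is_derive_affine (u : pt R -> R) (x v : pt R) : affine u ->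
  is_derive x v u (u (x + v) - u x).
Proof.
move=> au.
have e : (fun h => h^-1 *: ((u \o shift x) (h *: v) - u x)) @ 0^' --> u (x + v) - u x.
  apply: (@cvg_trans _ ((fun=> u (x + v) - u x) @ 0^')); last exact: cvg_cst.
  apply: near_eq_cvg; near=> h.
  have h0 : h != 0 by near: h; exact: nbhs_dnbhs_neq.
  rewrite /= [h *: v + x]addrC affine_line // [_ + h * _]addrC addrK /GRing.scale /=.
  by rewrite mulrA mulVf // mul1r.
apply: DeriveDef; first by apply/cvg_ex; exists (u (x + v) - u x).
by rewrite /derive; apply: cvg_lim e.
Unshelve. all: by end_near. Qed.

End AffineFunctions.

Section Dot3.
Variable R : realType.

Definition dot3 (n c : pt R) : R := n.1.1 * c.1.1 + n.1.2 * c.1.2 + n.2 * c.2.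

(** The determinant of a product of matrices, n0, n1, n2 being the rows of the
    first factor. *)
Lemma det3_dot3 n0 n1 n2 c0 c1 c2 :
  det3 ((dot3 n0 c0, dot3 n0 c1), dot3 n0 c2) ((dot3 n1 c0, dot3 n1 c1), dot3 n1 c2)
    ((dot3 n2 c0, dot3 n2 c1), dot3 n2 c2) = det3 n0 n1 n2 * det3 c0 c1 c2.
Proof. by rewrite /det3 /dot3 /=; ring. Qed.
End Dot3.

Section Barycentric.
Variables (R : realType) (a : 'I_4 -> pt R).

Lemma bary_affine i : affine (bary a i).
Proof.
set N := invmx (vertex_mx a).
exists (N ord0 i, (N (inord 1) i, N (inord 2) i, N (inord 3) i)) => x.
rewrite /bary mxE !big_ord_recl big_ord0 addr0 !mxE /= -/N !mul1r !addrA.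
have -> : lift ord0 ord0 = inord 1 :> 'I_4 by apply/val_inj; rewrite /= inordK.
have -> : lift ord0 (lift ord0 ord0) = inord 2 :> 'I_4 by apply/val_inj; rewrite /= inordK.
have -> : lift ord0 (lift ord0 (lift ord0 ord0)) = inord 3 :> 'I_4 by apply/val_inj; rewrite /= inordK.
by rewrite ![N _ _ * _]mulrC.
Qed.

Hypothesis nd : Defs.nondegenerate a.

Lemma bary_vertex i j : bary a i (a j) = (i == j)%:R.
Proof.
have -> : bary a i (a j) = (vertex_mx a *m invmx (vertex_mx a)) j i.
  rewrite /bary [LHS]mxE [RHS]mxE; apply: eq_bigr => k _.
  by rewrite [vertex_mx _ _ _]mxE.
by rewrite mulmxV // mxE eq_sym.
Qed.

Lemma bary_comb (l : 'I_4 -> R) i : \sum_j l j = 1 -> bary a i (\sum_j l j *: a j) = l i.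
Proof.
move=> l1; rewrite (affine_comb _ (bary_affine i)) // (bigD1 i) //=.
rewrite bary_vertex eqxx mulr1 big1 ?addr0 // => j ji.
by rewrite bary_vertex eq_sym (negbTE ji) mulr0.
Qed.

Lemma hom_coord_bary x j : \sum_i bary a i x * hom_coord (a i) 0 j = hom_coord x 0 j.
Proof.
transitivity ((hom_coord x *m invmx (vertex_mx a) *m vertex_mx a) 0 j).
  by rewrite mxE; apply: eq_bigr => i _; rewrite [vertex_mx _ _ _]mxE.
by rewrite mulmxKV.
Qed.

Lemma bary_sum x : \sum_i bary a i x = 1.
Proof.
have := hom_coord_bary x 0; rewrite [RHS]mxE /= => <-.
by apply: eq_bigr => i _; rewrite mxE mulr1.
Qed.

Lemma baryK x : \sum_i bary a i x *: a i = x.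
Proof.
rewrite sum_pt; case: x => -[x1 x2] x3.
have c := hom_coord_bary (x1, x2, x3).
congr (_, _, _); [move: (c (inord 1))|move: (c (inord 2))|move: (c (inord 3))];
  rewrite [RHS]mxE inordK //= => e; rewrite -[RHS]e;
  by apply: eq_bigr => i _; rewrite mxE inordK.
Qed.

Lemma tetE : tet a = [set x | forall i, 0 <= bary a i x].
Proof.
apply/seteqP; split => [x [l [l0 _ l1 ->]] i|x x0]; first by rewrite /= bary_comb.
exists (bary a ^~ x); split => //; last by rewrite baryK.
- by move=> i; rewrite inE.
- exact: bary_sum.
Qed.

Lemma hull_bary0 (J : {set 'I_4}) x i : hull a J x -> i \notin J -> bary a i x = 0.
Proof. by move=> [l [_ lJ l1 ->]] iJ; rewrite bary_comb // lJ. Qed.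

(** The vertices are affinely independent, so that the face with index set J
    has no other vertex than those with index in J. *)
Lemma hull_vertex (J : {set 'I_4}) i : hull a J (a i) -> i \in J.
Proof.
move=> hi; apply: contraT => /(hull_bary0 hi) /eqP.
by rewrite bary_vertex eqxx oner_eq0.
Qed.

Lemma vertex_hull (J : {set 'I_4}) i : i \in J -> hull a J (a i).
Proof.
move=> iJ; exists (fun j => (j == i)%:R); split.
- by move=> j; rewrite ler0n.
- by move=> j jJ; case: eqP jJ => // ->; rewrite iJ.
- by rewrite (bigD1 i) //= eqxx big1 ?addr0 // => j /negbTE ->.
- rewrite (bigD1 i) //= eqxx scale1r big1 ?addr0 // => j /negbTE ->.
  by rewrite scale0r.
Qed.

Lemma vertex_inj : injective a.
Proof.
move=> i j aij; have := bary_vertex i j; rewrite -aij bary_vertex eqxx.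
by case: eqP => // _ /eqP; rewrite oner_eq0.
Qed.

(** The barycentric coordinates of the reference simplex, whose last vertex is
    the origin. *)
Definition ref_coord (s : pt R) (m : 'I_4) : R :=
  [:: s.1.1; s.1.2; s.2; 1 - s.1.1 - s.1.2 - s.2]`_m.

(** The affine map that takes the reference simplex to the tetrahedron. *)
Definition chart (s : pt R) : pt R := \sum_m ref_coord s m *: a m.

Lemma sum_ref_coord s : \sum_m ref_coord s m = 1.
Proof. by rewrite sum4 /ref_coord !inordK //=; ring. Qed.

Lemma bary_chart s m : bary a m (chart s) = ref_coord s m.
Proof. by rewrite bary_comb // sum_ref_coord. Qed.

Lemma chart_preimage_tet : chart @^-1` tet a = @simplex3 R.
Proof.
rewrite tetE; apply/seteqP; split => s /= h.
  have h' m : 0 <= ref_coord s m by rewrite -bary_chart; exact: h.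
  have := h' (inord 0); have := h' (inord 1); have := h' (inord 2); have := h' (inord 3).
  by rewrite /ref_coord !inordK //= => ? ? ? ?; split => //; lra.
move=> m; rewrite bary_chart; case: h => s0 s1 s2 s3.
by case: m => -[|[|[|[|m]]]] //= ?; rewrite /ref_coord /=; lra.
Qed.

Let c0 := a (inord 0) - a (inord 3).
Let c1 := a (inord 1) - a (inord 3).
Let c2 := a (inord 2) - a (inord 3).

Lemma chart_lin3 s : chart s = lin3 c0 c1 c2 s + a (inord 3).
Proof.
rewrite /chart sum4 /ref_coord !inordK //= /lin3 /c0 /c1 /c2.
by rewrite !scalerBl scale1r !scalerBr; ring.
Qed.

(** The gradients of the first three barycentric coordinates form the dual
    basis of the edge vectors that start from the last vertex. *)
Lemma det3_neq0 : det3 c0 c1 c2 != 0.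
Proof.
have dual (i : 'I_4) : exists n, forall j : 'I_4, i != inord 3 ->
    dot3 n (a j - a (inord 3)) = (i == j)%:R.
  have [A uE] := bary_affine i; exists A.2 => j /negbTE i3.
  have := bary_vertex i j; have := bary_vertex i (inord 3).
  rewrite i3 mulr0n !uE /dot3 /= => h3 <-.
  by rewrite -[RHS]subr0 -[in RHS]h3; ring.
have eqI (i j : nat) : (i < 4)%N -> (j < 4)%N -> (inord i == inord j :> 'I_4) = (i == j).
  by move=> i4 j4; rewrite -val_eqE /= !inordK.
have [n0 d0] := dual (inord 0); have [n1 d1] := dual (inord 1); have [n2 d2] := dual (inord 2).
apply/eqP => c_eq0; have := det3_dot3 n0 n1 n2 c0 c1 c2; rewrite c_eq0 mulr0.
rewrite !d0 ?eqI // !d1 ?eqI // !d2 ?eqI // /det3 /= => /eqP.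
by rewrite !(mul0r, mulr0, mul1r, subr0, addr0) oner_eq0.
Qed.

Lemma scales_chart : exists c, scales (@mu3 R) c chart.
Proof.
have [c sc] := scales_lin3 det3_neq0.
exists (c * 1).
have -> : chart = (fun u : pt R => u + a (inord 3)) \o lin3 c0 c1 c2.
  by apply/funext => s; rewrite chart_lin3.
exact: scales_comp (scales_translation3 _) sc.
Qed.

End Barycentric.

(** * Moments of products of barycentric coordinates *)

Section HasIntegral.
Context d (T : measurableType d) (R : realType).
Variables (m : {measure set T -> \bar R}) (D : set T).
Hypothesis mD : measurable D.

(** Integrability and the value of the integral are kept together, so that an
    integral is computed by following the shape of the integrand. *)
Definition has_integral (f : T -> R) (v : R) :=
  m.-integrable D (EFin \o f) /\ \int[m]_(x in D) f x = v.

Lemma has_integral_ext f g v : (forall x, D x -> f x = g x) -> has_integral f v -> has_integral g v.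
Proof.
move=> fg [If vf]; split.
  by apply: (eq_integrable mD _ _ _ If) => x; rewrite inE => Dx; rewrite /= fg.
by rewrite -vf; apply: eq_Rintegral => x; rewrite inE => Dx; rewrite fg.
Qed.

Lemma has_integral_eq f v w : v = w -> has_integral f v -> has_integral f w.
Proof. by move=> ->. Qed.

Lemma has_integralZ c f v : has_integral f v -> has_integral (fun x => c * f x) (c * v).
Proof.
move=> [If vf]; split; last by rewrite RintegralZl // vf.
exact: (integrableZl mD c If).
Qed.

Lemma has_integralD f g v w :
  has_integral f v -> has_integral g w -> has_integral (fun x => f x + g x) (v + w).
Proof.
move=> [If vf] [Ig vg]; split; last by rewrite RintegralD // vf vg.
exact: (integrableD mD If Ig).
Qed.

Lemma has_integral0 : has_integral (fun=> 0) 0.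
Proof.
split; first exact: integrable0.
by rewrite /Rintegral integral0.
Qed.

Lemma has_integral_sum (I : finType) (f : I -> T -> R) v :
  (forall i, has_integral (f i) (v i)) -> has_integral (fun x => \sum_i f i x) (\sum_i v i).
Proof.
move=> fv; elim: (index_enum I) => [|i r IH].
  by rewrite big_nil; apply: has_integral_ext has_integral0 => x _; rewrite big_nil.
by rewrite big_cons; apply: has_integral_ext (has_integralD (fv i) IH) => x _; rewrite big_cons.
Qed.

Lemma has_integral_ge0 (f : T -> R) (v : R) : (forall x, D x -> 0 <= f x) -> measurable_fun D f ->
  (\int[m]_(x in D) (f x)%:E = v%:E)%E -> has_integral f v.
Proof.
move=> f0 mf fv; split; last by rewrite /Rintegral fv.
apply/integrableP; split; first exact/measurable_EFinP.
rewrite (eq_integral (fun x => (f x)%:E)) ?fv ?ltry // => x; rewrite inE => Dx.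
by rewrite /= ger0_norm // f0.
Qed.

End HasIntegral.

Section Multiplicity.
Variables (n : nat) (R : realType).
Implicit Types (s : seq 'I_n) (x : 'I_n -> R).

(** A monomial in the barycentric coordinates is given by the list s of the
    indices of its factors.  This is the product of the factorials of its
    exponents ([prod_count_fact]), in a form that can be computed factor by
    factor. *)
Fixpoint multfact s : nat :=
  if s is i :: s' then (count_mem i s').+1 * multfact s' else 1%N.

Lemma prod_count_fact s : (\prod_k (count_mem k s)`! = multfact s)%N.
Proof.
elim: s => [|i s IH] /=; first by rewrite big1.
rewrite -IH (bigD1 i) //= [in RHS](bigD1 i) //= eqxx add1n factS mulnA.
by congr (_ * _)%N; apply: eq_bigr => k ki; rewrite eq_sym (negbTE ki).
Qed.

Lemma prod_count_exp x s : \prod_k x k ^+ count_mem k s = \prod_(i <- s) x i.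
Proof.
elim: s => [|i s IH] /=; first by rewrite big_nil big1.
rewrite big_cons -IH (bigD1 i) //= [in RHS](bigD1 i) //= eqxx add1n exprS mulrA.
by congr (_ * _); apply: eq_bigr => k ki; rewrite eq_sym (negbTE ki).
Qed.

Lemma sum_count s : (\sum_k count_mem k s = size s)%N.
Proof.
elim: s => [|i s IH] /=; first by rewrite big1.
by rewrite big_split /= IH (bigD1 i) //= eqxx big1 // => k /negbTE; rewrite eq_sym => ->.
Qed.

End Multiplicity.

Section SimplexMoments.
Variable R : realType.
Notation R1 := (measurableTypeR R).

(** The order of the coordinates agrees with the parametrization
    b0 + s u + t w of the faces in [face_integral]. *)
Definition tri_coord (s : R * R) (k : 'I_3) : R := [:: 1 - s.1 - s.2; s.1; s.2]`_k.

Lemma has_integral_triangle (s : seq 'I_3) :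
  has_integral (@mu2 R) (@triangle R) (fun x => \prod_(i <- s) tri_coord x i)
    ((multfact s)%:R / (size s).+2`!%:R).
Proof.
pose c (k : nat) := count_mem (inord k : 'I_3) s.
have F0 : ord0 = inord 0 :> 'I_3 by apply/val_inj; rewrite /= inordK.
have F1 : lift ord0 ord0 = inord 1 :> 'I_3 by apply/val_inj; rewrite /= inordK.
have F2 : lift ord0 (lift ord0 ord0) = inord 2 :> 'I_3 by apply/val_inj; rewrite /= inordK.
have pE x : x.1 ^+ c 1%N * (x.2 ^+ c 2 * (1 - x.1 - x.2) ^+ c 0%N) = \prod_(i <- s) tri_coord x i.
  rewrite -prod_count_exp !big_ord_recl big_ord0 F2 F1 F0 -/(c 0%N) -/(c 1%N) -/(c 2).
  by rewrite /tri_coord !inordK //= mulr1 [RHS]mulrC -mulrA.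
apply: has_integral_ge0.
- move=> x [x1 x2 x12]; rewrite -pE !mulr_ge0 ?exprn_ge0 //; lra.
- apply: measurable_funTS; under eq_fun do rewrite -pE.
  apply: measurable_funM; first exact: measurable_funX.
  apply: measurable_funM; first exact: measurable_funX.
  by apply: measurable_funX; apply: measurable_funB => //; exact: measurable_funB.
under eq_integral do rewrite -pE.
rewrite ge0_integral_triangle -prod_count_fact -sum_count.
rewrite !big_ord_recl !big_ord0 F2 F1 F0 -/(c 0%N) -/(c 1%N) -/(c 2).
by congr (_ %:R / _ .+2`!%:R)%:E; lia.
Qed.

Lemma has_integral_simplex3 (s : seq 'I_4) :
  has_integral (@mu3 R) (@simplex3 R) (fun x => \prod_(i <- s) ref_coord x i)
    ((multfact s)%:R / (size s).+3`!%:R).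
Proof.
pose c (k : nat) := count_mem (inord k : 'I_4) s.
have F0 : ord0 = inord 0 :> 'I_4 by apply/val_inj; rewrite /= inordK.
have F1 : lift ord0 ord0 = inord 1 :> 'I_4 by apply/val_inj; rewrite /= inordK.
have F2 : lift ord0 (lift ord0 ord0) = inord 2 :> 'I_4 by apply/val_inj; rewrite /= inordK.
have F3 : lift ord0 (lift ord0 (lift ord0 ord0)) = inord 3 :> 'I_4 by apply/val_inj; rewrite /= inordK.
have pE x : x.1.1 ^+ c 0%N * x.1.2 ^+ c 1%N *
    (x.2 ^+ c 2 * (1 - x.1.1 - x.1.2 - x.2) ^+ c 3) = \prod_(i <- s) ref_coord x i.
  rewrite -prod_count_exp !big_ord_recl big_ord0 F3 F2 F1 F0 -/(c 0%N) -/(c 1%N) -/(c 2) -/(c 3).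
  by rewrite /ref_coord !inordK //= mulr1 !mulrA.
apply: has_integral_ge0.
- move=> x [x1 x2 x3 x123]; rewrite -pE !mulr_ge0 ?exprn_ge0 //; lra.
- apply: measurable_funTS; under eq_fun do rewrite -pE.
  apply: measurable_funM; apply: measurable_funM; apply: measurable_funX => //.
  + by apply: measurableT_comp.
  + by apply: measurableT_comp.
  + apply: measurable_funB => //; apply: measurable_funB => //.
      by apply: measurable_funB => //; apply: measurableT_comp.
    by apply: measurableT_comp.
under eq_integral do rewrite -pE.
rewrite ge0_integral_simplex3 -prod_count_fact -sum_count.
rewrite !big_ord_recl !big_ord0 F3 F2 F1 F0 -/(c 0%N) -/(c 1%N) -/(c 2) -/(c 3).
by congr (_ %:R / _ .+3`!%:R)%:E; lia.
Qed.

End SimplexMoments.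

(** * The bubble polynomial and its moments *)

Section Bubble.
Variable R : realType.

(** The index type is arbitrary because the formula is used with the four
    coordinates of a tetrahedron as well as with the three of a face. *)
Definition bubble (I : finType) (l : I -> R) : R :=
  12 - 45 * (\sum_i l i ^+ 2) + 35 * (\sum_i l i ^+ 3).

(** The next four lemmas write the factorials as polynomials in Kronecker
    deltas, so that sums over k need no distinction of cases. *)
Lemma multfact2 n (i j : 'I_n) :
  (multfact [:: i; j])%:R = 1 + (i == j)%:R :> R.
Proof. by rewrite /= addn0 !muln1 eq_sym -natr1 addrC. Qed.

Lemma multfact3 n (i j k : 'I_n) :
  (multfact [:: i; j; k])%:R =
  (1 + (i == j)%:R + 1 * (k == i)%:R) * (1 + 1 * (k == j)%:R) :> R.
Proof.
rewrite /= [i == j]eq_sym.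
by case: (j == i); case: (k == i); case: (k == j);
  rewrite /= ?mulr0n ?mulr1n; ring.
Qed.

Lemma multfact4 n (i j k : 'I_n) :
  (multfact [:: i; j; k; k])%:R =
  2 * ((1 + (i == j)%:R + 2 * (k == i)%:R) * (1 + 2 * (k == j)%:R)) :> R.
Proof.
rewrite /= eqxx [i == j]eq_sym.
by case: (j == i); case: (k == i); case: (k == j);
  rewrite /= ?mulr0n ?mulr1n; ring.
Qed.

Lemma multfact5 n (i j k : 'I_n) :
  (multfact [:: i; j; k; k; k])%:R =
  6 * ((1 + (i == j)%:R + 3 * (k == i)%:R) * (1 + 3 * (k == j)%:R)) :> R.
Proof.
rewrite /= eqxx [i == j]eq_sym.
by case: (j == i); case: (k == i); case: (k == j);
  rewrite /= ?mulr0n ?mulr1n; ring.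
Qed.

Lemma sum_delta2 (I : finType) (F : I -> R) (i j : I) A B C :
  \sum_k F k * ((A + B * (k == i)%:R) * (1 + C * (k == j)%:R)) =
  A * (\sum_k F k) + B * F i + A * C * F j + B * C * (i == j)%:R * F j.
Proof.
transitivity (\sum_k (A * F k + B * (F k * (k == i)%:R) + A * C * (F k * (k == j)%:R)
    + B * C * (F k * (k == i)%:R * (k == j)%:R))).
  by apply: eq_bigr => k _; ring.
have d3 : \sum_k F k * (k == i)%:R * (k == j)%:R = F j * (j == i)%:R :=
  sum_delta (fun k => F k * (k == i)%:R) j.
rewrite !big_split -!mulr_sumr /= d3 !sum_delta.
by rewrite [j == i]eq_sym; ring.
Qed.

(** With e := (m == n), the three terms of the bubble contribute
    12 (1 + e) / 24, - 45 (14 + 18 e) / 720 and 35 (54 + 90 e) / 5040, whose sum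
    is 0 for both values of e. *)
Lemma bubble_face_moment (m n : 'I_3) :
  has_integral (@mu2 R) (@triangle R) (fun s => bubble (tri_coord s) * (tri_coord s m * tri_coord s n)) 0.
Proof.
have mT := @measurable_triangle R.
have H0 := has_integralZ mT 12 (@has_integral_triangle R [:: m; n]).
have H1 := has_integralZ mT (-45) (has_integral_sum mT (fun i => @has_integral_triangle R [:: m; n; i; i])).
have H2 := has_integralZ mT 35 (has_integral_sum mT (fun i => @has_integral_triangle R [:: m; n; i; i; i])).
have H := has_integralD mT (has_integralD mT H0 H1) H2.
apply: (@has_integral_eq _ _ _ _ _ _ _ _ _ (has_integral_ext mT _ H)); last first.
  move=> x _.
  have E2 : \sum_i \prod_(k <- [:: m; n; i; i]) tri_coord x k =
      (\sum_i tri_coord x i ^+ 2) * (tri_coord x m * tri_coord x n).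
    by rewrite mulr_suml; apply: eq_bigr => i _; rewrite !big_cons big_nil; ring.
  have E3 : \sum_i \prod_(k <- [:: m; n; i; i; i]) tri_coord x k =
      (\sum_i tri_coord x i ^+ 3) * (tri_coord x m * tri_coord x n).
    by rewrite mulr_suml; apply: eq_bigr => i _; rewrite !big_cons big_nil; ring.
  by rewrite E2 E3 !big_cons big_nil /bubble; ring.
have S2 : \sum_(i < 3) (multfact [:: m; n; i; i])%:R / 6`!%:R = (14 + 18 * (m == n)%:R) / 720 :> R.
  have -> : (6`!)%:R = 720 :> R by [].
  rewrite -mulr_suml; congr (_ / _).
  have := sum_delta2 (fun=> 1) m n (1 + (m == n)%:R) 2 2.
  rewrite sumr_const card_ord => e.
  under eq_bigr do rewrite multfact4 -[X in 2 * X]mul1r.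
  by rewrite -mulr_sumr e; ring.
have S3 : \sum_(i < 3) (multfact [:: m; n; i; i; i])%:R / 7`!%:R = (54 + 90 * (m == n)%:R) / 5040 :> R.
  have -> : (7`!)%:R = 5040 :> R by rewrite !factS fact0; ring.
  rewrite -mulr_suml; congr (_ / _).
  have := sum_delta2 (fun=> 1) m n (1 + (m == n)%:R) 3 3.
  rewrite sumr_const card_ord => e.
  under eq_bigr do rewrite multfact5 -[X in 6 * X]mul1r.
  by rewrite -mulr_sumr e; ring.
rewrite S2 S3 multfact2 (_ : (size [:: m; n]).+2`!%:R = 24 :> R) //.
by field.
Qed.

(** The derivative of the bubble in a direction in which the m-th coordinate
    has the derivative sig m. *)
Definition bubble_grad (sig l : 'I_4 -> R) : R :=
  \sum_m sig m * (105 * l m ^+ 2 - 90 * l m).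

(** As the sum of sig is 0, only its values at p and at q contribute; the terms
    with (p == q) cancel between the squares and the linear terms. *)
Lemma bubble_grad_moment sig (p q : 'I_4) : \sum_m sig m = 0 ->
  has_integral (@mu3 R) (@simplex3 R)
    (fun s => bubble_grad sig (ref_coord s) * (ref_coord s p * ref_coord s q))
    (- (sig p + sig q) / 24).
Proof.
move=> sig0; have mT := @measurable_simplex3 R.
have H1 := has_integral_sum mT
  (fun i => has_integralZ mT (105 * sig i) (@has_integral_simplex3 R [:: p; q; i; i])).
have H2 := has_integral_sum mT
  (fun i => has_integralZ mT (- 90 * sig i) (@has_integral_simplex3 R [:: p; q; i])).
apply: (@has_integral_eq _ _ _ _ _ _ _ _ _ (has_integral_ext mT _ (has_integralD mT H1 H2))); last first.
  move=> x _; rewrite /bubble_grad mulr_suml -big_split; apply: eq_bigr => i _ /=.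
  by rewrite !big_cons big_nil; ring.
have S1 : \sum_i 105 * sig i * ((multfact [:: p; q; i; i])%:R / 7`!%:R) =
    105 * 2 / 5040 * (2 * sig p + (1 + (p == q)%:R) * 2 * sig q + 2 * 2 * (p == q)%:R * sig q).
  rewrite (_ : (7`!)%:R = 5040 :> R); last by rewrite !factS fact0; ring.
  have := sum_delta2 sig p q (1 + (p == q)%:R) 2 2.
  rewrite sig0 mulr0 add0r => <-; rewrite mulr_sumr.
  by apply: eq_bigr => i _; rewrite multfact4; ring.
have S2 : \sum_i (- 90) * sig i * ((multfact [:: p; q; i])%:R / 6`!%:R) =
    - 90 / 720 * (1 * sig p + (1 + (p == q)%:R) * 1 * sig q + 1 * 1 * (p == q)%:R * sig q).
  rewrite (_ : (6`!)%:R = 720 :> R); last by rewrite !factS fact0; ring.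
  have := sum_delta2 sig p q (1 + (p == q)%:R) 1 1.
  rewrite sig0 mulr0 add0r => <-; rewrite mulr_sumr.
  by apply: eq_bigr => i _; rewrite multfact3; ring.
by rewrite S1 S2; field.
Qed.

End Bubble.

(** * Polynomials are determined almost everywhere *)

Section Polynomials.
Variable R : realType.
Implicit Types (f g : pt R -> R) (x : pt R).
Notation R1 := (measurableTypeR R).

Definition mono (i j k : nat) x : R := x.1.1 ^+ i * x.1.2 ^+ j * x.2 ^+ k.

Lemma Pm_ext m f g : f =1 g -> Pm m f -> Pm m g.
Proof. by move=> /funext ->. Qed.

(** A polynomial as a sum over one finite type; closure properties then
    follow from those of monomials. *)
Lemma Pm_expand m f : Pm m f ->
  exists c : 'I_m.+1 * 'I_m.+1 * 'I_m.+1 -> R,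
    (forall t : 'I_m.+1 * 'I_m.+1 * 'I_m.+1, (m < t.1.1 + t.1.2 + t.2)%N -> c t = 0) /\
    forall x, f x = \sum_t c t * mono t.1.1 t.1.2 t.2 x.
Proof.
move=> [c fE].
exists (fun t : 'I_m.+1 * 'I_m.+1 * 'I_m.+1 =>
  if (t.1.1 + t.1.2 + t.2 <= m)%N then c t.1.1 t.1.2 t.2 else 0); split.
  by move=> t; rewrite ltnNge => /negbTE ->.
move=> x; rewrite fE pair_bigA /= pair_big_dep /= big_mkcond /=.
apply: eq_bigr => t _; case: ifP => _; last by rewrite mul0r.
by rewrite /mono !mulrA.
Qed.

Lemma Pm0 m : Pm m (fun=> 0 : R).
Proof.
exists (fun _ _ _ => 0) => x; rewrite big1 // => i _; rewrite big1 // => j _.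
by rewrite big1 // => k _; rewrite !mul0r.
Qed.

Lemma PmD m f g : Pm m f -> Pm m g -> Pm m (fun x => f x + g x).
Proof.
move=> [c fE] [c' gE]; exists (fun i j k => c i j k + c' i j k) => x.
rewrite fE gE -big_split; apply: eq_bigr => i _; rewrite -big_split.
apply: eq_bigr => j _; rewrite -big_split; apply: eq_bigr => k _ /=.
by rewrite !mulrDl.
Qed.

Lemma Pm_sum m (I : finType) (f : I -> pt R -> R) :
  (forall i, Pm m (f i)) -> Pm m (fun x => \sum_i f i x).
Proof.
move=> fm; elim: (index_enum I) => [|i r IH].
  by apply: Pm_ext (Pm0 m) => x; rewrite big_nil.
by apply: Pm_ext (PmD (fm i) IH) => x; rewrite big_cons.
Qed.

Lemma Pm_mono m c i j k : (i + j + k <= m)%N -> Pm m (fun x => c * mono i j k x).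
Proof.
move=> ijk; have hi : (i < m.+1)%N by lia.
have hj : (j < m.+1)%N by lia. have hk : (k < m.+1)%N by lia.
exists (fun i' j' k' => if [&& i' == i, j' == j & k' == k] then c else 0) => x.
rewrite (bigD1 (Ordinal hi)) //= [X in _ = _ + X]big1 ?addr0; last first.
  move=> i' /negbTE; rewrite -val_eqE /= => ->.
  by rewrite big1 // => j' _; rewrite big1 // => k' _; rewrite !mul0r.
rewrite (bigD1 (Ordinal hj)) //= [X in _ = _ + X]big1 ?addr0; last first.
  move=> j' /negbTE; rewrite -val_eqE /= => ->.
  by rewrite big1 // => k' _; rewrite andbF !mul0r.
rewrite (bigD1 (Ordinal hk)) //= [X in _ = _ + X]big1 ?addr0; last first.
  by move=> k' /andP[_ /negbTE]; rewrite -val_eqE /= => ->; rewrite !andbF !mul0r.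
by rewrite !eqxx /mono !mulrA.
Qed.

Lemma PmM m n f g : Pm m f -> Pm n g -> Pm (m + n) (fun x => f x * g x).
Proof.
move=> /Pm_expand[c [c0 fE]] /Pm_expand[c' [c'0 gE]].
apply: (@Pm_ext _ (fun x => \sum_t \sum_t' c t * c' t' *
    mono (t.1.1 + t'.1.1) (t.1.2 + t'.1.2) (t.2 + t'.2) x)).
  move=> x; rewrite fE gE big_distrl; apply: eq_bigr => t _.
  rewrite big_distrr; apply: eq_bigr => t' _ /=.
  by rewrite /mono !exprD; ring.
apply: Pm_sum => t; apply: Pm_sum => t'.
have [tm|tm] := leqP (t.1.1 + t.1.2 + t.2) m; last first.
  by apply: Pm_ext (Pm0 _) => x; rewrite c0 // !mul0r.
have [t'm|t'm] := leqP (t'.1.1 + t'.1.2 + t'.2) n; last first.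
  by apply: Pm_ext (Pm0 _) => x; rewrite c'0 // mulr0 mul0r.
by apply: Pm_mono; lia.
Qed.

Lemma Pm_le m n f : (m <= n)%N -> Pm m f -> Pm n f.
Proof.
move=> mn /Pm_expand[c [c0 fE]].
apply: (@Pm_ext _ (fun x => \sum_t c t * mono t.1.1 t.1.2 t.2 x)) => //.
apply: Pm_sum => t; have [tm|tm] := leqP (t.1.1 + t.1.2 + t.2) m.
  by apply: Pm_mono; exact: leq_trans tm mn.
by apply: Pm_ext (Pm0 _) => x; rewrite c0 // !mul0r.
Qed.

Lemma Pm_cst m c : Pm m (fun=> c : R).
Proof.
by apply: Pm_ext (@Pm_mono m c 0 0 0 isT) => x; rewrite /mono !expr0 !mulr1.
Qed.

Lemma PmZ m c f : Pm m f -> Pm m (fun x => c * f x).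
Proof. exact: (PmM (Pm_cst 0 c)). Qed.

Lemma PmX m n f : Pm m f -> Pm (n * m) (fun x => f x ^+ n).
Proof.
move=> fm; elim: n => [|n IH]; first exact: Pm_cst.
by apply: Pm_ext (PmM fm IH) => x; rewrite exprS.
Qed.

Lemma Pm_affine f : affine f -> Pm 1 f.
Proof.
move=> [[A0 [[A1 A2] A3]] fE].
apply: (@Pm_ext _ (fun x => A0 + (A1 * mono 1 0 0 x + A2 * mono 0 1 0 x + A3 * mono 0 0 1 x))).
  by move=> x; rewrite fE /mono /= !expr0 !expr1 !mulr1 !mul1r.
apply: PmD; first exact: Pm_cst.
by apply: PmD; [apply: PmD|]; apply: Pm_mono.
Qed.

Lemma measurable_Pm m f : Pm m f -> measurable_fun setT (f : R1 * R1 * R1 -> R1).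
Proof.
move=> /Pm_expand[c [_ /funext ->]]; apply: measurable_sum => t.
apply: measurable_funM => //; apply: measurable_funM; first apply: measurable_funM.
- by apply: measurable_funX; exact: measurableT_comp.
- by apply: measurable_funX; exact: measurableT_comp.
- exact: measurable_funX.
Qed.

Lemma continuous_Pm m f : Pm m f -> continuous f.
Proof.
move=> /Pm_expand[c [_ /funext ->]] x.
elim: (index_enum _) => [|t r IH].
  by under eq_fun do rewrite big_nil; exact: cvg_cst.
under eq_fun do rewrite big_cons; apply: (@cvgD _ _ _ _ _ _ _ _ _ _ IH).
apply: cvgM; first exact: cvg_cst.
apply: cvgM; first apply: cvgM.
- apply: (@continuous_comp _ _ _ (fun x : pt R => x.1.1) (fun z => z ^+ t.1.1)); last exact: exprn_continuous.
  apply: (@continuous_comp _ _ _ fst fst); exact: cvg_fst.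
- apply: (@continuous_comp _ _ _ (fun x : pt R => x.1.2) (fun z => z ^+ t.1.2)); last exact: exprn_continuous.
  apply: (@continuous_comp _ _ _ fst snd); [exact: cvg_fst|exact: cvg_snd].
- apply: (@continuous_comp _ _ _ (fun x : pt R => x.2) (fun z => z ^+ t.2)); last exact: exprn_continuous.
  exact: cvg_snd.
Qed.

Lemma Pm_line m f x d : Pm m f -> exists P : {poly R}, forall t, f (x + t *: d) = P.[t].
Proof.
move=> /Pm_expand[c [_ fE]].
exists (\sum_t (c t)%:P * ((x.1.1%:P + d.1.1%:P * 'X) ^+ t.1.1 *
   (x.1.2%:P + d.1.2%:P * 'X) ^+ t.1.2 * (x.2%:P + d.2%:P * 'X) ^+ t.2)) => t.
rewrite fE horner_sum; apply: eq_bigr => i _.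
by rewrite /mono !hornerE /= ![_ * t]mulrC.
Qed.

(** On a line a polynomial in space is a polynomial in one variable, which is 0
    if it has infinitely many roots. *)
Lemma Pm_line_eq0 m f x d (delta : R) : Pm m f -> 0 < delta ->
  (forall t, 0 < t <= delta -> f (x + t *: d) = 0) -> f (x + d) = 0.
Proof.
move=> fm d0 f0; have [P fP] := Pm_line x d fm.
suff P0 : P = 0 by rewrite -[d]scale1r fP P0 horner0.
apply/eqP; apply: contraT => P0.
pose rs := [seq delta / k.+1%:R | k <- iota 0 (size P)].
have := @max_poly_roots _ P rs P0; rewrite size_map size_iota ltnn => -> //.
  apply/allP => _ /mapP[k _ ->]; rewrite /root -fP f0 //.
  by rewrite divr_gt0 ?ltr0n //= ler_pdivrMr ?ltr0n // ler_peMr ?ler1n // ltW.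
rewrite map_inj_uniq ?iota_uniq // => k k' /(mulfI (lt0r_neq0 d0)) /invr_inj /eqP.
by rewrite eqr_nat => /eqP[].
Qed.

Lemma ball_mu3 (x : pt R) (e : R) : 0 < e ->
  measurable (ball x e : set (R1 * R1 * R1)) /\ (0 < @mu3 R (ball x e))%E.
Proof.
move=> e0.
have bE : ball x e = (ball x.1.1 e `*` ball x.1.2 e) `*` ball x.2 e.
  by apply/seteqP; split => -[[y1 y2] y3].
have mb (z : R) : measurable (ball z e : set R1) by rewrite ball_itv; exact: measurable_itv.
have lb (z : R) : (0 < @lebesgue_measure R (ball z e))%E.
  by rewrite lebesgue_measure_ball ?ltW // lte_fin mulrn_wgt0.
rewrite bE; split; first by apply: measurableX => //; apply: measurableX.
rewrite mu3_setX //; last exact: measurableX.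
by rewrite mu2_setX // !mule_gt0.
Qed.

End Polynomials.

Section Uniqueness.
Variables (R : realType) (a : 'I_4 -> pt R).
Hypothesis nd : Defs.nondegenerate a.
Notation R1 := (measurableTypeR R).

Let center : pt R := \sum_i 4^-1 *: a i.

Lemma bary_center i : bary a i center = 4^-1.
Proof. by rewrite bary_comb // sum4; field. Qed.

Lemma bary_continuous i : continuous (bary a i).
Proof. exact: (continuous_Pm (Pm_affine (bary_affine a i))). Qed.

Lemma open_bary_gt0 : open [set x | forall i, 0 < bary a i x].
Proof.
rewrite openE => x bx; apply: (@filter_forall _ _ (fun i y => 0 < bary a i y) (nbhs x)) => i.
by have /cvgr_gt/(_ _ (bx i)) := @bary_continuous i x.
Qed.

(** By continuity f vanishes where all the barycentric coordinates are
    positive, since balls have positive measure.  Every point is joined to the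
    centroid by a line that contains a segment of such points. *)
Lemma Pm_ae_eq0 m f : Pm m f -> ae_eq (@mu3 R) (tet a) f (fun=> 0) -> f = fun=> 0.
Proof.
move=> fm [N [mN N0 fN]].
have f0 x : (forall i, 0 < bary a i x) -> f x = 0.
  move=> bx; apply/eqP; apply: contraT => fx0.
  have : nbhs x ([set y | forall i, 0 < bary a i y] `&` [set y | f y != 0]).
    apply: filterI; first exact: (open_bary_gt0 bx).
    by have /cvgr_neq0/(_ fx0) := continuous_Pm fm (x := x).
  rewrite nbhs_ballP => -[e /= e0 bN].
  have [mb lb] := ball_mu3 x e0.
  suff : (@mu3 R (ball x e) <= @mu3 R N)%E by rewrite (N0 : @mu3 R N = 0%E) leNgt lb.
  apply: le_measure; rewrite ?inE // => y /bN [by0 /eqP fy0]; apply: fN => /= h.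
  by apply: fy0; apply: h; rewrite tetE // => i; exact: ltW.
apply/funext => x.
rewrite -[x](subrKC center).
(* At x0 + t (x - x0), with x0 the centroid, the i-th coordinate is
   (1 - t) / 4 + t bary a i x, which is positive for 0 < t <= 1 / (8 K). *)
pose K := \sum_i `|bary a i x| + 1.
have K1 : 1 <= K by rewrite lerDr sumr_ge0.
apply: (Pm_line_eq0 (delta := (8 * K)^-1) fm); first by rewrite invr_gt0; nra.
move=> t /andP[t0 tK]; apply: f0 => i.
rewrite affine_line; last exact: bary_affine.
rewrite subrKC bary_center.
have bK : - K <= bary a i x.
  rewrite lerNl; apply: (le_trans (ler_norm _)); rewrite normrN /K (bigD1 i) //=.
  by rewrite -addrA lerDl addr_ge0 // sumr_ge0.
have tK8 : t * K <= 8^-1.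
  by rewrite -ler_pdivlMr ?(lt_le_trans _ K1) // -invfM.
nra.
Qed.

End Uniqueness.

Section Restriction.
Variables (R : realType) (a : 'I_4 -> pt R).
Hypothesis nd : Defs.nondegenerate a.

Lemma restr_unique m v p : Pm m p -> ae_eq (@mu3 R) (tet a) v p -> restr a v = p.
Proof.
move=> pm vp; rewrite /restr; case: xgetP => [p' _ [[m' p'm'] vp']|/(_ p)].
  apply/funext => x; apply/eqP; rewrite -subr_eq0; apply/eqP.
  have dm : Pm (maxn m m') (fun x => p' x + (-1) * p x).
    by apply: PmD; [apply: Pm_le p'm'|apply: PmZ; apply: Pm_le pm]; lia.
  have := Pm_ae_eq0 nd dm; move=> /(_ _)/(congr1 (fun f => f x)); rewrite mulN1r; apply.
  apply: filterS2 vp vp' => y vp vp' ty.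
  by rewrite -vp // -vp' // mulN1r subrr.
by move=> H; case: H; split=> //; exists m.
Qed.

(** When no polynomial agrees with v almost everywhere, [restr a v] is v
    itself. *)
Lemma restr_ae_eq m v : Pm m (restr a v) -> ae_eq (@mu3 R) (tet a) v (restr a v).
Proof.
rewrite /restr; case: xgetP => [p' _ [_ //]|_ _]; exact: ae_eq_refl.
Qed.

End Restriction.

(** * Integration over a tetrahedron *)

Section Null.
Variable R : realType.
Notation R1 := (measurableTypeR R).

Lemma ref_coord_affine (i : 'I_4) : affine (fun s : pt R => ref_coord s i).
Proof.
case: i => -[|[|[|[|//]]]] hi; rewrite /ref_coord /=.
- by exists (0, (1, 0, 0)) => x /=; ring.
- by exists (0, (0, 1, 0)) => x /=; ring.
- by exists (0, (0, 0, 1)) => x /=; ring.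
- by exists (1, (-1, -1, -1)) => x /=; ring.
Qed.

Lemma measurable_affine0 (u : pt R -> R) : affine u ->
  measurable ([set x | u x = 0] : set (R1 * R1 * R1)).
Proof.
move=> /Pm_affine/measurable_Pm mu.
rewrite (_ : [set x | u x = 0] = u @^-1` [set 0]) //.
by rewrite -[X in measurable X]setTI; exact: mu.
Qed.

Lemma graph_null (g : R1 * R1 -> R1) :
  measurable ([set u | u.2 = g u.1] : set (R1 * R1 * R1)) ->
  @mu3 R [set u | u.2 = g u.1] = 0.
Proof.
move=> mg; rewrite /mu3 /product_measure1 integral0_eq // => p _ /=.
rewrite (_ : xsection _ _ = [set g p]) ?lebesgue_measure_set1 //.
by apply/seteqP; split => z; rewrite /xsection /= inE.
Qed.

(** Two of the face planes of the reference simplex are products with a point as a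
    factor, and the other two are graphs over the first two coordinates. *)
Lemma ref_coord_null (i : 'I_4) : @mu3 R [set s | ref_coord s i = 0] = 0.
Proof.
have mi := measurable_affine0 (ref_coord_affine i).
have l0 : @lebesgue_measure R [set 0] = 0 by exact: lebesgue_measure_set1.
case: i mi => -[|[|[|[|//]]]] hi; rewrite /ref_coord /= => mi.
- rewrite (_ : [set s | _] = ([set 0] `*` setT) `*` setT); last first.
    by apply/seteqP; split => -[[x y] z] //= [[]].
  rewrite mu3_setX //; last exact: measurableX.
  by rewrite mu2_setX // l0 !mul0e.
- rewrite (_ : [set s | _] = (setT `*` [set 0]) `*` setT); last first.
    by apply/seteqP; split => -[[x y] z] //= [[]].
  rewrite mu3_setX //; last exact: measurableX.
  by rewrite mu2_setX // l0 mule0 !mul0e.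
- exact: (graph_null (g := fun=> 0)).
- have e : [set s : pt R | 1 - s.1.1 - s.1.2 - s.2 = 0] = [set s | s.2 = 1 - s.1.1 - s.1.2].
    by apply/seteqP; split => -[[x y] z] /= h; lra.
  by rewrite e in mi *; exact: (graph_null (g := fun p => 1 - p.1 - p.2)).
Qed.

End Null.

Section TetIntegral.
Variables (R : realType) (a : 'I_4 -> pt R).
Hypothesis nd : Defs.nondegenerate a.
Notation R1 := (measurableTypeR R).

Lemma bary_null i : (@mu3 R).-negligible [set x | bary a i x = 0].
Proof.
have mi := measurable_affine0 (bary_affine a i).
have [c [mc c0 cE]] := scales_chart nd.
apply/negligibleP => //; have := cE _ mi.
rewrite (_ : _ @^-1` _ = [set s | ref_coord s i = 0]); last first.
  by apply/seteqP; split => s /=; rewrite bary_chart.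
rewrite (ref_coord_null R i : @mu3 R _ = 0%E) => /esym/eqP.
by rewrite mule_eq0 eqe gt_eqF //= => /eqP.
Qed.

Lemma measurable_tet : measurable (tet a : set (R1 * R1 * R1)).
Proof.
rewrite tetE //.
rewrite (_ : [set x | _] = \bigcap_(i in [set: 'I_4]) (bary a i @^-1` `[0, +oo[)); last first.
  apply/seteqP; split => x /= h i; first by move=> _; rewrite /= in_itv /= andbT.
  by have := h i I; rewrite /= in_itv /= andbT.
apply: fin_bigcap_measurable => // i _.
have mb := measurable_Pm (Pm_affine (bary_affine a i)).
by rewrite -[X in measurable X]setTI; exact: mb.
Qed.

(** The change of variables for nonnegative functions, applied to the positive
    and to the negative part of f. *)
Lemma has_integral_chart c (f : pt R -> R) w : scales (@mu3 R) c (chart a) ->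
  measurable_fun setT (f : R1 * R1 * R1 -> R1) ->
  has_integral (@mu3 R) (@simplex3 R) (f \o chart a) w -> has_integral (@mu3 R) (tet a) f (c^-1 * w).
Proof.
move=> sc mf [If vf]; have [_ c0 _] := sc.
have mt := measurable_tet.
have S (g : pt R -> \bar R) :
    measurable_fun (tet a) (g : R1 * R1 * R1 -> \bar R) -> (forall x, (0 <= g x)%E) ->
    (\int[@mu3 R]_(x in @simplex3 R) g (chart a x) = c%:E * \int[@mu3 R]_(x in tet a) g x)%E.
  by move=> mg g0; rewrite -(chart_preimage_tet nd) (ge0_integral_scales sc).
have mF : measurable_fun (tet a) (EFin \o f : R1 * R1 * R1 -> \bar R).
  by apply/measurable_EFinP; exact: measurable_funTS.
have fin (g : pt R -> \bar R) :
    measurable_fun (tet a) (g : R1 * R1 * R1 -> \bar R) -> (forall x, (0 <= g x)%E) ->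
    (forall x, (g x <= `|(f x)%:E|)%E) -> (\int[@mu3 R]_(x in tet a) g x < +oo)%E.
  move=> mg g0 gf; have : (c%:E * \int[@mu3 R]_(x in tet a) g x < +oo)%E.
    rewrite -S //; case/integrableP: If => mf'; apply: le_lt_trans.
    apply: ge0_le_integral => //; first exact: measurable_simplex3.
    - have [mc _ _] := sc; apply: (@measurable_comp _ _ _ _ _ _ (tet a)) mg _ => //.
      + by move=> _ [s ss <-]; rewrite -(chart_preimage_tet nd) in ss.
      + exact: measurable_funTS.
    - exact: measurableT_comp.
  rewrite ltey => h; rewrite ltey; apply: contra h => /eqP ->.
  by rewrite gt0_muley // lte_fin.
have IF : (@mu3 R).-integrable (tet a) (EFin \o f).
  apply/integrableP; split => //; apply: (fin (fun x => `|(f x)%:E|%E)) => //.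
  exact: measurableT_comp.
split => //.
rewrite -vf /Rintegral; apply: (mulfI (lt0r_neq0 c0)); rewrite mulrA divff ?gt_eqF // mul1r.
have fp : (\int[@mu3 R]_(x in tet a) (EFin \o f)^\+ x \is a fin_num)%E.
  rewrite ge0_fin_numE ?integral_ge0 //; apply: fin => //; first exact: measurable_funepos.
  by move=> x; rewrite -/((abse \o (EFin \o f)) x) fune_abse leeDl.
have fn : (\int[@mu3 R]_(x in tet a) (EFin \o f)^\- x \is a fin_num)%E.
  rewrite ge0_fin_numE ?integral_ge0 //; apply: fin => //; first exact: measurable_funeneg.
  by move=> x; rewrite -/((abse \o (EFin \o f)) x) fune_abse leeDr.
have Sp := S _ (measurable_funepos mF) (funepos_ge0 (EFin \o f)).
have Sn := S _ (measurable_funeneg mF) (funeneg_ge0 (EFin \o f)).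
have Ep : (\int[@mu3 R]_(x in @simplex3 R) (EFin \o (f \o chart a))^\+ x =
    \int[@mu3 R]_(x in @simplex3 R) (EFin \o f)^\+ (chart a x))%E.
  by apply: eq_integral => x _; rewrite !funeposE.
have En : (\int[@mu3 R]_(x in @simplex3 R) (EFin \o (f \o chart a))^\- x =
    \int[@mu3 R]_(x in @simplex3 R) (EFin \o f)^\- (chart a x))%E.
  by apply: eq_integral => x _; rewrite !funenegE.
have eT : (\int[@mu3 R]_(x in tet a) (f x)%:E = \int[@mu3 R]_(x in tet a) (EFin \o f)^\+ x
    - \int[@mu3 R]_(x in tet a) (EFin \o f)^\- x)%E by rewrite -integralE.
have eS : (\int[@mu3 R]_(x in @simplex3 R) (f (chart a x))%:E =
    \int[@mu3 R]_(x in @simplex3 R) (EFin \o (f \o chart a))^\+ x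
    - \int[@mu3 R]_(x in @simplex3 R) (EFin \o (f \o chart a))^\- x)%E by rewrite -integralE.
rewrite eT eS Ep En Sp Sn -(fineK fp) -(fineK fn) /=.
by rewrite mulrBr.
Qed.

Lemma tet_fin : (@mu3 R (tet a) < +oo)%E.
Proof.
have [c sc] := scales_chart nd; have [_ c0 _] := sc.
have := @has_integral_simplex3 R [::]; under [X in has_integral _ _ X]eq_fun do rewrite big_nil.
move=> h; have [] := has_integral_chart (f := fun=> 1) sc (measurable_cst _) h.
move=> /integrableP[_]; rewrite /= normr1.
rewrite integral_cst ?mul1e //; exact: measurable_tet.
Qed.

End TetIntegral.

(** * The bubble as a function in space *)

Section BubbleCalculus.
Variable R : realType.

Lemma is_derive_bubble (a : 'I_4 -> pt R) (x v : pt R) :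
  is_derive x v (fun y => bubble (fun m => bary a m y))
   (\sum_m (105 * bary a m x ^+ 2 - 90 * bary a m x) * (bary a m (x + v) - bary a m x)).
Proof.
have db m := is_derive_affine x v (bary_affine a m).
have dX n m : is_derive x v (fun y => bary a m y ^+ n.+1)
    (n.+1%:R * bary a m x ^+ n * (bary a m (x + v) - bary a m x)).
  by have := is_deriveX n.+1 (db m); rewrite exprfctE.
have dS n : is_derive x v (fun y => \sum_m bary a m y ^+ n.+1)
    (\sum_m n.+1%:R * bary a m x ^+ n * (bary a m (x + v) - bary a m x)).
  by have := is_derive_sum (fun m => dX n m); rewrite fct_sumE.
have d := is_deriveD (is_deriveD (is_derive_cst (12 : R) x v) (is_deriveZ (-45) (dS 1)))
  (is_deriveZ 35 (dS 2)).
have -> : (fun y => bubble (fun m => bary a m y)) = cst 12 +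
    -45 \*: (fun y => \sum_m bary a m y ^+ 2) + 35 \*: (fun y => \sum_m bary a m y ^+ 3).
  by apply/funext => y; rewrite /bubble -mulNr.
apply: is_derive_eq d _.
rewrite add0r !scaler_sumr -big_split; apply: eq_bigr => m _ /=.
by rewrite /GRing.scale /= expr1; ring.
Qed.

Lemma Pm_bubble (a : 'I_4 -> pt R) : Pm 3 (fun y => bubble (fun m => bary a m y)).
Proof.
have bX n (m : 'I_4) : Pm n (fun x => bary a m x ^+ n).
  by have := PmX n (Pm_affine (bary_affine a m)); rewrite muln1.
apply: (@Pm_ext _ _ (fun y => (12 + (-45) * \sum_m bary a m y ^+ 2) + 35 * \sum_m bary a m y ^+ 3)).
  by move=> y; rewrite /bubble mulNr.
apply: PmD; [apply: PmD; [exact: Pm_cst|]|]; apply: PmZ; apply: Pm_sum => m //.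
exact: Pm_le (bX _ m).
Qed.

(** A product of two affine functions is a quadratic form in the barycentric
    coordinates even if its degree is less than 2; this is why the moments
    against the products l_p l_q suffice. *)
Lemma Pm2_prod (p : pt R -> R) : Pm 2 p ->
  exists (I : finType) (u v : I -> pt R -> R),
    [/\ forall t, affine (u t), forall t, affine (v t) &
        forall x, p x = \sum_t u t x * v t x].
Proof.
move=> /Pm_expand[c [c0 pE]].
have a1 b : affine (fun x : pt R => b * x.1.1) by exists (0, (b, 0, 0)) => x /=; ring.
have a2 b : affine (fun x : pt R => b * x.1.2) by exists (0, (0, b, 0)) => x /=; ring.
have a3 b : affine (fun x : pt R => b * x.2) by exists (0, (0, 0, b)) => x /=; ring.
have ac b : affine (fun x : pt R => b) by exists (b, (0, 0, 0)) => x /=; ring.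
have uv (t : 'I_3 * 'I_3 * 'I_3) : exists w : (pt R -> R) * (pt R -> R),
   [/\ affine w.1, affine w.2 & forall x, c t * mono t.1.1 t.1.2 t.2 x = w.1 x * w.2 x].
  have [t2|t2] := ltnP 2 (t.1.1 + t.1.2 + t.2)%N.
    by exists (fun=> 0, fun=> 0); split=> [||x] /=; rewrite ?c0 ?mul0r.
  rewrite /mono; move: (c t) t2; case: t => -[[i Hi] [j Hj]] [k Hk] b /= {Hi Hj Hk}.
  case: i => [|[|[|i]]] //; case: j => [|[|[|j]]] //; case: k => [|[|[|k]]] // _.
  - by exists (fun=> b, fun=> 1); split=> [||x] /=; [by []|by []|ring].
  - by exists (fun x => b * x.2, fun=> 1); split=> [||x] /=; [by []|by []|ring].
  - by exists (fun x => b * x.2, fun x => 1 * x.2); split=> [||x] /=; [by []|by []|ring].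
  - by exists (fun x => b * x.1.2, fun=> 1); split=> [||x] /=; [by []|by []|ring].
  - by exists (fun x => b * x.1.2, fun x => 1 * x.2); split=> [||x] /=; [by []|by []|ring].
  - by exists (fun x => b * x.1.2, fun x => 1 * x.1.2); split=> [||x] /=; [by []|by []|ring].
  - by exists (fun x => b * x.1.1, fun=> 1); split=> [||x] /=; [by []|by []|ring].
  - by exists (fun x => b * x.1.1, fun x => 1 * x.2); split=> [||x] /=; [by []|by []|ring].
  - by exists (fun x => b * x.1.1, fun x => 1 * x.1.2); split=> [||x] /=; [by []|by []|ring].
  - by exists (fun x => b * x.1.1, fun x => 1 * x.1.1); split=> [||x] /=; [by []|by []|ring].
have [w wP] := choice uv.
exists _, (fun t => (w t).1), (fun t => (w t).2); split.
- by move=> t; have [] := wP t.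
- by move=> t; have [] := wP t.
- by move=> x; rewrite pE; apply: eq_bigr => t _; have [_ _ ->] := wP t.
Qed.

End BubbleCalculus.

Section Midpoints.
Variables (R : realType) (a : 'I_4 -> pt R).
Hypothesis nd : Defs.nondegenerate a.
Variables (i j k l : 'I_4).
Hypothesis ijkl : uniq [:: i; j; k; l].

Let sig m : R := bary a m (midpoint a i j) - bary a m (midpoint a k l).

Lemma sigE m : sig m = 2^-1 * ((m == i)%:R + (m == j)%:R - (m == k)%:R - (m == l)%:R).
Proof. by rewrite /sig !affine_midpoint ?bary_vertex //; [field|exact: bary_affine..]. Qed.

Lemma sum_sig (F : 'I_4 -> R) : \sum_m sig m * F m = (F i + F j - F k - F l) / 2.
Proof.
transitivity (2^-1 * (\sum_m F m * (m == i)%:R + \sum_m F m * (m == j)%:R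
   - \sum_m F m * (m == k)%:R - \sum_m F m * (m == l)%:R)); last by rewrite !sum_delta mulrC.
rewrite -big_split -!sumrB mulr_sumr; apply: eq_bigr => m _ /=.
by rewrite sigE; ring.
Qed.

Lemma sum_uniq4 (F : 'I_4 -> R) : \sum_m F m = F i + F j + F k + F l.
Proof.
rewrite (perm_big [:: i; j; k; l]).
  by rewrite !big_cons big_nil /= addr0 !addrA.
apply: uniq_perm => //; first exact: index_enum_uniq.
have [| |_ ijklE] := @uniq_min_size _ _ (enum 'I_4) ijkl.
- by move=> m; rewrite mem_enum.
- by rewrite size_enum_ord.
by move=> m; rewrite mem_index_enum ijklE mem_enum.
Qed.

(** For p = u v with u and v affine, the moments of l_m l_n give
    - ((\sum sig u) (\sum v) + (\sum u) (\sum sig v)) / 24, the sums being over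
    the vertices, and \sum sig u = (u_i + u_j - u_k - u_l) / 2.  With
    U1 = u_i + u_j, U2 = u_k + u_l and likewise V1, V2, this is
    - (U1 V1 - U2 V2) / 24, where U1 V1 / 4 is the value of p at the midpoint
    of the edge ij. *)
Lemma midpoint_moment p : Pm 2 p ->
  has_integral (@mu3 R) (@simplex3 R) (fun s => bubble_grad sig (ref_coord s) * p (chart a s))
    (- (p (midpoint a i j) - p (midpoint a k l)) / 6).
Proof.
move=> /Pm2_prod[I [u [v [au av pE]]]].
have mT := @measurable_simplex3 R.
have sig0 : \sum_m sig m = 0.
  by have := sum_sig (fun=> 1); under eq_bigr do rewrite mulr1; move=> ->; field.
have H t := has_integral_sum mT (fun m => has_integral_sum mT (fun n =>
   has_integralZ mT (u t (a m) * v t (a n)) (bubble_grad_moment m n sig0))).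
apply: (@has_integral_eq _ _ _ _ _ _ _ _ _ (has_integral_ext mT _ (has_integral_sum mT H))); last first.
  move=> s _; move: (bubble_grad sig (ref_coord s)) => g; rewrite pE mulr_sumr; apply: eq_bigr => t _.
  rewrite /chart !(affine_comb (l := ref_coord s)) ?sum_ref_coord //.
  rewrite big_distrl /= mulr_sumr; apply: eq_bigr => m _.
  rewrite big_distrr /= mulr_sumr; apply: eq_bigr => n _.
  by ring.
rewrite !pE -sumrB -sumrN mulr_suml; apply: eq_bigr => t _.
rewrite !affine_midpoint //.
transitivity (- (1 / 24) * ((\sum_m sig m * u t (a m)) * (\sum_n v t (a n)) +
    (\sum_m u t (a m)) * (\sum_n sig n * v t (a n)))).
  rewrite !big_distrl /= -big_split mulr_sumr; apply: eq_bigr => m _ /=.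
  rewrite !big_distrr /= -big_split mulr_sumr; apply: eq_bigr => n _ /=.
  by field.
by rewrite !sum_sig !sum_uniq4; field.
Qed.

End Midpoints.

(** * The bubble field of one cell *)

Section FaceMoments.
Variable R : realType.

(** The point with face coordinates mu has the barycentric coordinates mu,
    moved along the embedding sigma of the vertices and extended by 0; power
    sums do not see the zeros. *)
Lemma bubble_inj_face (sigma : 'I_3 -> 'I_4) (mu : 'I_3 -> R) : injective sigma ->
  bubble (fun n => \sum_m mu m * (n == sigma m)%:R) = bubble mu.
Proof.
move=> sinj.
have e p : \sum_n (\sum_m mu m * (n == sigma m)%:R) ^+ p.+1 = \sum_m mu m ^+ p.+1.
  transitivity (\sum_n \sum_m mu m ^+ p.+1 * (n == sigma m)%:R).
    apply: eq_bigr => n _; have [[m' ->]|nn] := pselect (exists m', n = sigma m').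
      have s (F : 'I_3 -> R) : \sum_m F m * (sigma m' == sigma m)%:R = F m'.
        by rewrite -[RHS]sum_delta; apply: eq_bigr => m _; rewrite (inj_eq sinj) eq_sym.
      by rewrite !s.
    have n0 m : (n == sigma m)%:R = 0 :> R by case: eqP => // nm; case: nn; exists m.
    by rewrite !big1 ?expr0n // => m _; rewrite n0 mulr0.
  rewrite exchange_big; apply: eq_bigr => m _ /=.
  exact: (sum_delta (fun=> mu m ^+ p.+1)).
by rewrite /bubble !e.
Qed.

Lemma sum_tri_coord (s : R * R) : \sum_m tri_coord s m = 1.
Proof. by rewrite !big_ord_recl big_ord0 /tri_coord /=; ring. Qed.

(** The face may be parametrized through any cell that has it, since the
    moments of the bubble do not depend on the order of the vertices. *)
Lemma face_integral_bubble (a b : 'I_4 -> pt R) (i : 'I_4) (sigma : 'I_3 -> 'I_4) W :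
  Defs.nondegenerate b -> injective sigma -> (forall m, a (lift i m) = b (sigma m)) ->
  Pm 2 W -> face_integral a i (fun x => bubble (fun n => bary b n x) * W x) = 0.
Proof.
move=> nd sinj ab /Pm2_prod[I [u [v [au av WE]]]].
have mT := @measurable_triangle R.
have pE (s : R * R) : a (lift i (inord 0)) + s.1 *: (a (lift i (inord 1)) - a (lift i (inord 0)))
   + s.2 *: (a (lift i (inord 2)) - a (lift i (inord 0))) = \sum_m tri_coord s m *: b (sigma m).
  rewrite sum3 /tri_coord !inordK //= -!ab !scalerBl scale1r !scalerBr.
  ring.
rewrite /face_integral; apply/eqP; rewrite mulf_eq0; apply/orP; right; apply/eqP.
have H t := has_integral_sum mT (fun m => has_integral_sum mT (fun n =>
   has_integralZ mT (u t (b (sigma m)) * v t (b (sigma n))) (bubble_face_moment R m n))).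
have := has_integral_sum mT H.
have -> : \sum_t \sum_m \sum_n u t (b (sigma m)) * v t (b (sigma n)) * 0 = 0 :> R.
  by rewrite big1 // => t _; rewrite big1 // => m _; rewrite big1 // => n _; rewrite mulr0.
move=> H0; set f := (fun s : R * R => _ * _).
suff : has_integral (@mu2 R) (@triangle R) f 0 by case.
apply: (has_integral_ext mT) H0 => s _; rewrite /f /= pE WE.
have -> : (fun n => bary b n (\sum_m tri_coord s m *: b (sigma m))) =
    (fun n => \sum_m tri_coord s m * (n == sigma m)%:R).
  apply/funext => n; rewrite (affine_comb _ (bary_affine b n)) ?sum_tri_coord //.
  by apply: eq_bigr => m _; rewrite bary_vertex.
rewrite bubble_inj_face //; move: (bubble (tri_coord s)) => g.
rewrite mulr_sumr; apply: eq_bigr => t _.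
rewrite !(affine_comb (l := tri_coord s)) ?sum_tri_coord //.
rewrite big_distrl /= mulr_sumr; apply: eq_bigr => m _.
rewrite big_distrr /= mulr_sumr; apply: eq_bigr => n _.
by ring.
Qed.

End FaceMoments.

Section InteriorTet.
Variables (R : realType) (a : 'I_4 -> pt R).
Hypothesis nd : Defs.nondegenerate a.
Notation R1 := (measurableTypeR R).

(** If the i-th coordinate of x is 0, the points x + t (x - a i) with t > 0
    have a negative one and are arbitrarily close to x. *)
Lemma interior_tet : interior (tet a) = [set x | forall i, 0 < bary a i x].
Proof.
apply/seteqP; split => x /= h; last first.
  apply: (@filterS _ _ _ [set x | forall i, 0 < bary a i x]); last exact: open_bary_gt0.
  by move=> y by0; rewrite tetE // => i; exact: ltW.
move=> i; rewrite lt_neqAle; apply/andP; split; last first.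
  by have := nbhs_singleton h; rewrite tetE // => /(_ i).
apply/eqP => bi0.
have /nbhs_ballP[e /= e0 eb] := h.
have cl : (fun t : R => x + t *: (x - a i)) @ (0 : R) --> x + 0 *: (x - a i).
  apply: cvgD; first exact: cvg_cst.
  by apply: cvgZr_tmp; exact: cvg_id.
rewrite scale0r addr0 in cl.
have := cl _ h.
move=> /nbhs_ballP[r /= r0 rb].
have /rb : ball (0 : R) r (r / 2).
  rewrite /ball /= sub0r normrN gtr0_norm ?divr_gt0 //; lra.
rewrite tetE // => /(_ i).
rewrite affine_extend; last exact: bary_affine.
by rewrite bary_vertex // eqxx mulr1n -bi0 => ?; lra.
Qed.

Lemma measurable_interior_tet : measurable (interior (tet a) : set (R1 * R1 * R1)).
Proof.
rewrite interior_tet.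
rewrite (_ : [set x | _] = \bigcap_(i in [set: 'I_4]) (bary a i @^-1` `]0, +oo[)); last first.
  apply/seteqP; split => x /= h i; first by move=> _; rewrite /= in_itv /= andbT.
  by have := h i I; rewrite /= in_itv /= andbT.
apply: fin_bigcap_measurable => // i _.
have mb := measurable_Pm (Pm_affine (bary_affine a i)).
by rewrite -[X in measurable X]setTI; exact: mb.
Qed.

Lemma negligible_not_interior : (@mu3 R).-negligible (tet a `\` interior (tet a)).
Proof.
pose Z i := [set x | bary a i x = 0].
have U : (@mu3 R).-negligible (Z (inord 0) `|` Z (inord 1) `|` Z (inord 2) `|` Z (inord 3)).
  by do 3 (apply: negligibleU; last exact: bary_null); exact: bary_null.
apply: negligibleS U => x [tx /= nix].
have [i bi0] : exists i, bary a i x = 0.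
  apply: contrapT => nz; apply: nix; rewrite interior_tet => i.
  rewrite tetE // in tx; rewrite lt_neqAle tx andbT eq_sym.
  by apply/eqP => bi0; apply: nz; exists i.
have : Z (inord i) x by rewrite inord_val.
move: (nat_of_ord i) (ltn_ord i) => [|[|[|[|//]]]] _ zi.
- by do 3 left.
- by do 2 left; right.
- by left; right.
- by right.
Qed.

End InteriorTet.

Section SingleCell.
Variables (R : realType) (a : 'I_4 -> pt R).
Hypothesis nd : Defs.nondegenerate a.
Notation R1 := (measurableTypeR R).

Definition bubble_field (d : pt R) (j : 'I_3) : pt R -> R :=
  (fun x => Defs.coord d j * bubble (fun m => bary a m x)) \_ (tet a).

(** Coarse: each of the two power sums lies between 0 and 4. *)
Lemma bubble_le400 x : tet a x -> `|bubble (fun m => bary a m x)| <= 400.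
Proof.
rewrite tetE // => b0.
have b1 i : bary a i x <= 1.
  by rewrite -(bary_sum nd x) (bigD1 i) //= lerDl sumr_ge0.
have S n : 0 <= \sum_i bary a i x ^+ n <= 4.
  apply/andP; split; first by apply: sumr_ge0 => i _; rewrite exprn_ge0.
  apply: (le_trans (ler_sum _ (fun i _ => exprn_ile1 n (b0 i) (b1 i)))).
  by rewrite sumr_const card_ord.
rewrite /bubble; have /andP[? ?] := S 2%N; have /andP[? ?] := S 3.
by rewrite ler_norml; apply/andP; split; lra.
Qed.

Lemma bubble_field_inL2 (M : set (pt R)) d j : tet a `<=` M -> inL2 M (bubble_field d j).
Proof.
move=> aM; rewrite /inL2.
have -> : bubble_field d j \_ M = bubble_field d j.
  apply/funext => x; rewrite patchE; case: ifPn => // /negP xM.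
  by rewrite /bubble_field patchE ifN //; apply/negP; rewrite inE => /aM ax; apply: xM; rewrite inE.
have mt := measurable_tet nd.
have Pb : Pm 3 (fun x => Defs.coord d j * bubble (fun m => bary a m x)).
  by apply: PmZ; exact: Pm_bubble.
have mf : measurable_fun setT (bubble_field d j : R1 * R1 * R1 -> R1).
  by apply/(measurable_restrictT _ mt); apply: measurable_funTS; exact: measurable_Pm Pb.
rewrite inE; apply/andP; split; rewrite inE //= /finite_norm unlock poweR_lty //.
have C0 : 0 <= (Defs.coord d j * 400) ^+ 2 by rewrite sqr_ge0.
have cfin : (\int[@mu3 R]_(x in tet a) (cst ((Defs.coord d j * 400) ^+ 2)%:E) x < +oo)%E.
  by rewrite integral_cst // lte_mul_pinfty ?lee_fin //; exact: tet_fin.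
apply: le_lt_trans cfin; rewrite [leRHS]integral_mkcond.
have sqE x : (`|(EFin \o bubble_field d j) x| `^ 2 = (bubble_field d j x ^+ 2)%:E)%E.
  by rewrite /= powR_mulrn // real_normK ?num_real.
under eq_integral do rewrite sqE.
apply: ge0_le_integral => //.
- by move=> x _; rewrite lee_fin sqr_ge0.
- by apply/measurable_EFinP; exact: measurable_funX.
- by apply/(measurable_restrictT _ mt); exact: measurable_cst.
move=> x _; rewrite /bubble_field !patchE; case: ifPn => [|_].
  rewrite inE => /bubble_le400 bx; rewrite lee_fin !exprMn ler_wpM2l ?sqr_ge0 //.
  rewrite -[leLHS]real_normK ?num_real //.
  by apply: lerXn2r bx; rewrite nnegrE; [exact: normr_ge0|exact: ler0n].
by rewrite expr0n.
Qed.

Lemma restr_bubble_field d j :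
  restr a (bubble_field d j) = fun x => Defs.coord d j * bubble (fun m => bary a m x).
Proof.
apply: (@restr_unique _ _ nd 3); first by apply: PmZ; exact: Pm_bubble.
by apply: aeW => x tx; rewrite /bubble_field patchE ifT // inE.
Qed.

Lemma restr_disjoint_bubble_field (b : 'I_4 -> pt R) (J : {set 'I_4}) d j :
  Defs.nondegenerate b -> J != [set: 'I_4]%SET -> tet b `&` tet a = hull b J ->
  restr b (bubble_field d j) = fun=> 0.
Proof.
move=> ndb JT baJ; apply: (@restr_unique _ _ ndb 0); first exact: Pm0.
have [m mJ] : exists m, m \notin J.
  apply/existsP; rewrite -negb_forall; apply: contra JT => /forallP JT.
  by apply/eqP/setP => m; rewrite JT inE.
apply: negligibleS (bary_null ndb m) => x /= nx; apply: (hull_bary0 ndb _ mJ).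
rewrite -baJ; apply: contrapT => nab; apply: nx => tbx.
rewrite /bubble_field patchE ifN //; apply/negP; rewrite inE => tax; exact: nab.
Qed.

(** The divergence of b d is the derivative of b in the direction d. *)
Lemma divergence_bubble_field d x :
  divergence (fun j => restr a (bubble_field d j)) x =
  bubble_grad (fun m => bary a m (x + d) - bary a m x) (fun m => bary a m x).
Proof.
rewrite /divergence.
have dE j : 'D_(unit_vec R j) (restr a (bubble_field d j)) x = Defs.coord d j *
   \sum_m (105 * bary a m x ^+ 2 - 90 * bary a m x) * (bary a m (x + unit_vec R j) - bary a m x).
  rewrite restr_bubble_field.
  have := is_deriveZ (Defs.coord d j) (is_derive_bubble a x (unit_vec R j)).
  by move=> /@derive_val.
under eq_bigr do rewrite dE.
rewrite /bubble_grad.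
under eq_bigr do rewrite mulr_sumr.
rewrite exchange_big; apply: eq_bigr => m _ /=.
move: (105 * _ - 90 * _) => g; rewrite sum3 /Defs.coord /unit_vec !inordK //=.
have [A bE] := bary_affine a m; rewrite !bE /=; ring.
Qed.

End SingleCell.

(** * The bubble field in a grid *)

Section Grid.
Variables (R : realType) (th : grid R) (Omega : set (pt R)).
Hypothesis thP : tetrahedral_grid th Omega.

Let nd (K : cell th) : Defs.nondegenerate (vtx K).
Proof. by have [+ _ _] := thP; apply. Qed.

Lemma face_sub_tet (a : 'I_4 -> pt R) i : face a i `<=` tet a.
Proof. by move=> x [l [l0 li l1 xE]]; exists l; split => // m; rewrite inE. Qed.

(** By conformity the common face is spanned by common vertices of the two
    cells, but the two numberings may differ. *)
Lemma shared_face_vertices (K T : cell th) i i' : K != T ->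
  face (vtx K) i = face (vtx T) i' ->
  exists2 sigma : 'I_3 -> 'I_4, injective sigma &
    forall m, vtx K (lift i m) = vtx T (sigma m).
Proof.
move=> KT fE; have [_ _ /(_ _ _ KT)[_ KTE]] := thP.
have vT m : exists n, vtx K (lift i m) = vtx T n.
  have fm : face (vtx K) i (vtx K (lift i m)).
    by apply: vertex_hull; rewrite !inE eq_sym neq_lift.
  have : hull (vtx K) (common K T) (vtx K (lift i m)).
    rewrite -KTE; split; first exact: face_sub_tet fm.
    by rewrite fE in fm; exact: face_sub_tet fm.
  by move=> /(hull_vertex (nd K)); rewrite inE => /existsP[n /eqP ->]; exists n.
have [sigma sE] := choice vT; exists sigma => // m n smn.
by apply: (lift_inj (h := i)); apply: (vertex_inj (nd K)); rewrite !sE smn.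
Qed.

Variables (M : set (pt R)) (T : cell th).
Hypothesis TM : tet (vtx T) `<=` M.

Lemma restr_other_cell K d j : K != T ->
  restr (vtx K) (bubble_field (vtx T) d j) = fun=> 0.
Proof.
move=> KT; have [_ _ /(_ _ _ KT)[cT KTE]] := thP.
exact: (restr_disjoint_bubble_field _ _ (nd K) cT KTE).
Qed.

Lemma Pm_dot_coord m (w : 'I_3 -> pt R -> R) (d : pt R) :
  (forall j, Pm m (w j)) -> Pm m (fun x => \sum_j Defs.coord d j * w j x).
Proof. by move=> wm; apply: Pm_sum => j; exact: PmZ. Qed.

Lemma face_integral0 (a : 'I_4 -> pt R) i f : (forall x, f x = 0) -> face_integral a i f = 0.
Proof.
move=> /funext ->; rewrite /face_integral.
by have [_ ->] := has_integral0 (@mu2 R) (@triangle R); rewrite mulr0.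
Qed.

(** On both sides of every face the traces are 0 or b d, and in the latter case
    the face belongs to T, where the moments of b vanish. *)
Lemma V0_bubble_field d : V0 th M (bubble_field (vtx T) d).
Proof.
have rT j : restr (vtx T) (bubble_field (vtx T) d j) = _ := restr_bubble_field (nd T) d j.
have bT w i : P2_vector w ->
    face_integral (vtx T) i (fun x => \sum_j restr (vtx T) (bubble_field (vtx T) d j) x * w j x) = 0.
  move=> w2; rewrite -[RHS](face_integral_bubble (W := fun x => \sum_j Defs.coord d j * w j x) (nd T)
    (@lift_inj _ i) (fun=> erefl) (Pm_dot_coord _ w2)).
  congr face_integral; apply/funext => x; rewrite mulr_sumr; apply: eq_bigr => j _.
  by rewrite rT; ring.
split.
- by move=> j; exact: bubble_field_inL2.
- move=> K j KM; exists (restr (vtx K) (bubble_field (vtx T) d j)).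
    have [->|KT] := eqVneq K T; last by rewrite restr_other_cell //; exact: Pm0.
    by rewrite rT; apply: PmZ; exact: Pm_bubble.
  exists (fun=> 0) => x /=; rewrite big1 ?addr0 // => k _; exact: mul0r.
- move=> K K' i i' KM K'M KK' fE w w2.
  have [KT|KT] := eqVneq K T.
    rewrite -[RHS](bT w i w2) KT; congr face_integral; apply/funext => x.
    by apply: eq_bigr => j _; rewrite [restr (vtx K') _]restr_other_cell ?subr0 // -KT eq_sym.
  have [K'T|K'T] := eqVneq K' T; last first.
    apply: face_integral0 => x; rewrite big1 // => j _.
    by rewrite !restr_other_cell // subrr mul0r.
  rewrite K'T in fE *.
  have [sigma sinj sE] := shared_face_vertices KT fE.
  rewrite -[RHS](face_integral_bubble (W := fun x => - 1 * \sum_j Defs.coord d j * w j x) (nd T)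
    sinj sE (PmZ _ (Pm_dot_coord _ w2))).
  congr face_integral; apply/funext => x; rewrite !mulr_sumr; apply: eq_bigr => j _.
  by rewrite restr_other_cell // rT; ring.
- move=> K i KM _ w w2; have [->|KT] := eqVneq K T; first exact: bT.
  apply: face_integral0 => x; rewrite big1 // => j _.
  by rewrite restr_other_cell // mul0r.
Qed.

Lemma div_h_bubble_field d x :
  div_h th M (bubble_field (vtx T) d) x =
  \1_(interior (tet (vtx T))) x *
  divergence (fun j => restr (vtx T) (bubble_field (vtx T) d j)) x.
Proof.
rewrite /div_h (bigD1 T) /=; last by apply/asboolP.
rewrite big1 ?addr0 // => K /andP[_ KT]; rewrite /divergence big1 ?mulr0 // => j _.
rewrite restr_other_cell //; exact: derive_cst.
Qed.

End Grid.

Section Conclusion.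
Variables (R : realType) (th : grid R) (Omega : set (pt R)).
Hypothesis thP : tetrahedral_grid th Omega.
Variables (M : set (pt R)) (T : cell th).
Hypothesis TM : tet (vtx T) `<=` M.
Notation R1 := (measurableTypeR R).

(** The integral of div_h v q over M is that of (D_d b) q over T, and pulled
    back to the reference simplex it is a nonzero multiple of the difference of
    the two values. *)
Lemma midpoint_eq q i j k l : uniq [:: i; j; k; l] -> NM th M q ->
  restr (vtx T) q (midpoint (vtx T) i j) = restr (vtx T) q (midpoint (vtx T) k l).
Proof.
move=> ijkl [[qL2 qP2 _] qN].
have [ndg _ _] := thP; have nd := ndg T.
set a := vtx T in nd *; set p := restr a q.
have p2 : Pm 2 p by exact: qP2.
have qp : ae_eq (@mu3 R) (tet a) q p by exact: restr_ae_eq p2.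
pose d : pt R := midpoint a i j - midpoint a k l.
pose sig m : R := bary a m (midpoint a i j) - bary a m (midpoint a k l).
pose G x := bubble_grad sig (fun m => bary a m x).
have := qN _ (V0_bubble_field thP TM d).
have mt := measurable_tet nd.
have PG : Pm 2 G.
  rewrite /G /bubble_grad; apply: Pm_sum => m; apply: PmZ.
  have b1 := Pm_affine (bary_affine a m).
  apply: (@Pm_ext _ _ (fun x => 105 * bary a m x ^+ 2 + (-90) * bary a m x)).
    by move=> x; rewrite mulNr.
  by apply: PmD; apply: PmZ; [have := PmX 2 b1|exact: Pm_le b1].
have divE x : divergence (fun j => restr a (bubble_field a d j)) x = G x.
  rewrite divergence_bubble_field //; congr bubble_grad.
  by apply/funext => m; rewrite affine_diff //; exact: bary_affine.
have mG : measurable_fun setT (G : R1 * R1 * R1 -> R1) := measurable_Pm PG.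
have mp : measurable_fun setT (p : R1 * R1 * R1 -> R1) := measurable_Pm p2.
have mGp : measurable_fun setT ((fun x => G x * p x) : R1 * R1 * R1 -> R1) by exact: measurable_funM.
have -> : \int[@mu3 R]_(x in M) (div_h th M (bubble_field a d) x * q x) =
    \int[@mu3 R]_(x in tet a) (G x * p x).
  rewrite /Rintegral; congr fine.
  (* Restricting q to M keeps the integrand measurable on the whole space:
     square integrability is known for q on M only. *)
  pose F x := \1_(interior (tet a)) x * G x * (q \_ M) x.
  transitivity (\int[@mu3 R]_x (F x)%:E)%E.
    rewrite integral_mkcond; apply: eq_integral => x _.
    rewrite patchE (div_h_bubble_field thP TM) divE /F patchE; case: ifPn => xM //.
    by rewrite mulr0.
  rewrite [RHS]integral_mkcond; apply: ae_eq_integral => //.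
  - apply/measurable_EFinP; apply: measurable_funM.
      apply: measurable_funM => //; apply: measurable_indic.
      exact: measurable_interior_tet.
    by move: qL2; rewrite /inL2 inE => /andP[+ _]; rewrite inE.
  - by apply/(measurable_restrictT _ mt); apply/measurable_EFinP; exact: measurable_funTS.
  apply: negligibleS (negligibleU (negligible_not_interior nd) qp) => x /= nx.
  apply: contrapT => /not_orP[ni /contrapT nq]; apply: nx => _.
  rewrite patchE; case: ifPn => [|/negP] xt; last first.
    rewrite /F indicE memNset ?mul0r // => /interior_subset ix; apply: xt; rewrite inE; exact: ix.
  rewrite inE in xt; have ix : interior (tet a) x by apply: contrapT => ix; exact: ni.
  by rewrite /F indicE mem_set // mul1r patchE ifT ?inE ?nq //; exact: TM.
have [c sc] := scales_chart nd; have [_ c0 _] := sc.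
have H : has_integral (@mu3 R) (@simplex3 R) ((fun x => G x * p x) \o chart a)
    (- (p (midpoint a i j) - p (midpoint a k l)) / 6).
  apply: (has_integral_ext (@measurable_simplex3 R)) (midpoint_moment nd ijkl p2) => s _ /=.
  by rewrite /G; congr (bubble_grad _ _ * _); apply/funext => m; rewrite bary_chart.
have [_ ->] := has_integral_chart nd sc mGp H.
move=> /eqP; rewrite !mulf_eq0 !invr_eq0 gt_eqF //= pnatr_eq0 orbF oppr_eq0 subr_eq0.
by move/eqP.
Qed.

End Conclusion.

Theorem lemma7 (R : realType) (Omega : set (pt R))
    (H : Type) (Th : H -> grid R) (h : H)
    (OmegaP : polyhedral_lipschitz_domain Omega)
    (ThP : forall h', tetrahedral_grid (Th h') Omega)
    (ThU : quasi_uniform Th)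
    (ThI : forall K : cell (Th h), exists i, Omega (vtx K i))
    (a : pt R) (aP : internal_vertex (Th h) Omega a)
    (T : cell (Th h)) (TM : tet (vtx T) `<=` macro (Th h) a)
    (q : pt R -> R) (qN : NM (Th h) (macro (Th h) a) q)
    (i j k l : 'I_4) (ijkl : uniq [:: i; j; k; l])
    (ij : (i < j)%N) (kl : (k < l)%N) :
  restr (vtx T) q (midpoint (vtx T) i j) =
  restr (vtx T) q (midpoint (vtx T) k l).
Proof. exact: (midpoint_eq (ThP h) TM ijkl qN). Qed.
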